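(* Let $d\in\mathbb{N}$. (i) Let $s>0$. Then $$\lim_{n\to\infty}\frac{n^s\,a_n(I_d:H^{s,+}_{\rm mix}(\mathbb{T}^d)\to L_2(\mathbb{T}^d))}{(\ln n)^{(d-1)s}}=\Big[\frac{2^d}{(d-1)!}\Big]^s .$$ (ii) Let $s_0>s_1\ge0$. Then $$\lim_{n\to\infty}\frac{n^{s_0-s_1}\,a_n(I_d:H^{s_0,+}_{\rm mix}(\mathbb{T}^d)\to H^{s_1,+}_{\rm mix}(\mathbb{T}^d))}{(\ln n)^{(d-1)(s_0-s_1)}}=\Big[\frac{2^d}{(d-1)!}\Big]^{s_0-s_1} .$$
   Context: $\mathbb{N}=\{1,2,3,\dots\}$. $\mathbb{T}^d$ is the $d$-torus, represented by $[0,2\pi]^d$ with opposite sides identified. $L_2(\mathbb{T}^d)$ carries the norm $\|f|L_2(\mathbb{T}^d)\|=(\int_{\mathbb{T}^d}|f(x)|^2dx)^{1/2}$, and for $f\in L_2(\mathbb{T}^d)$ the Fourier coefficients are $c_k(f)=(2\pi)^{-d/2}\int_{\mathbb{T}^d}f(x)e^{-ikx}dx$, $k\in\mathbb{Z}^d$ (so $\|f|L_2(\mathbb{T}^d)\|^2=\sum_k|c_k(f)|^2$). For $s\ge0$, $H^{s,+}_{\rm mix}(\mathbb{T}^d)$ is the space of all $f\in L_2(\mathbb{T}^d)$ for which the norm $$\|f|H^s_{\rm mix}(\mathbb{T}^d)\|^{+}=\Big[\sum_{k\in\mathbb{Z}^d}|c_k(f)|^2\prod_{j=1}^d(1+|k_j|^2)^{s}\Big]^{1/2}$$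 is finite, equipped with this norm (for $s=0$ this is $L_2(\mathbb{T}^d)$). $I_d$ denotes the identical embedding $f\mapsto f$. The approximation numbers of a bounded linear operator $T:X\to Y$ between Banach spaces are $a_n(T:X\to Y)=\inf\{\|T-A:X\to Y\| : A:X\to Y \text{ bounded linear},\ {\rm rank}\,A<n\}$, $n\in\mathbb{N}$. *)

(* Defs.v *)
From HB Require Import structures.
From mathcomp Require Import all_boot all_order all_algebra generic_quotient.
From mathcomp Require Import ring_quotient complex.
From mathcomp Require Import all_classical all_reals all_analysis.

Set Implicit Arguments.
Unset Strict Implicit.
Unset Printing Implicit Defensive.

Import Order.TTheory GRing.Theory Num.Theory.
Import numFieldNormedType.Exports.
Import Normc.

Local Open Scope classical_set_scope.
Local Open Scope ring_scope.
Local Open Scope complex_scope.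
Local Open Scope quotient_scope.

(* T^d is represented by d-tuples of reals.  torus_measure is the d-fold product
   of Lebesgue measure on [0, 2 pi]: it is concentrated on the cube [0, 2 pi]^d,
   whose boundary is negligible, so that classes of functions modulo equality
   almost everywhere are classes of functions on the torus. *)
Section torus_measure.
Context (R : realType).

Definition circle : set (measurableTypeR R) := `[0, 2 * pi]%classic.

Lemma measurable_circle : measurable circle.
Proof. exact: measurable_itv. Qed.

Lemma lebesgue_measure_circle : (lebesgue_measure circle < +oo)%E.
Proof.
by rewrite lebesgue_measure_itv; case: ifP => // _; rewrite -EFinB ltry.
Qed.

Definition circle_measure : {finite_measure set (measurableTypeR R) -> \bar R} :=
  mfrestr measurable_circle lebesgue_measure_circle.

Definition consT n (p : measurableTypeR R * n.-tuple (measurableTypeR R)) :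
  n.+1.-tuple (measurableTypeR R) := [tuple of p.1 :: p.2].

Lemma measurable_consT n : measurable_fun setT (@consT n).
Proof. exact: measurable_cons. Qed.

Section step.
Context n (mu : {finite_measure set (n.-tuple (measurableTypeR R)) -> \bar R}).

Definition torus_measureS : set (n.+1.-tuple (measurableTypeR R)) -> \bar R :=
  pushforward (circle_measure \x mu)%E (@consT n).

HB.instance Definition _ := Measure.copy torus_measureS
  (measure_function_pushforward__canonical__measure_function_Measure
     (product_measure1 circle_measure mu) (@measurable_consT n)).

Let torus_measureS_fin : fin_num_fun torus_measureS.
Proof.
have fin1 : (circle_measure \x mu)%E setT \is a fin_num.
  rewrite -setXTT product_measure1E//.
  by rewrite fin_numM// fin_num_measure.
move=> U mU; rewrite ge0_fin_numE ?measure_ge0//.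
have mV : measurable (@consT n @^-1` U).
  by rewrite -[X in measurable X]setTI; apply: measurable_consT.
rewrite /torus_measureS /pushforward.
apply: (@le_lt_trans _ _ ((circle_measure \x mu)%E setT)).
  by apply: le_measure; rewrite ?inE.
by rewrite -ge0_fin_numE.
Qed.

HB.instance Definition _ :=
  Measure_isFinite.Build _ _ _ torus_measureS torus_measureS_fin.

End step.

Fixpoint torus_measure d :
    {finite_measure set (d.-tuple (measurableTypeR R)) -> \bar R} :=
  match d with
  | 0 => \d_([tuple] : 0.-tuple (measurableTypeR R))
  | n.+1 => torus_measureS (torus_measure n)
  end.
End torus_measure.

Section L2.
Context d (T : measurableType d) (R : realType).
Variable mu : {measure set T -> \bar R}.

(* Complex-valued square-integrable functions: R[i] carries no measurable
   structure, hence the condition on real and imaginary parts. *)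
Definition L2pred : {pred T -> R[i]^o} := fun f =>
  ((fun x => complex.Re (f x)) \in Lfun mu 2%:E) && ((fun x => complex.Im (f x)) \in Lfun mu 2%:E).

Lemma L2pred_submod_closed : submod_closed L2pred.
Proof.
have p1 : (1 <= 2%:E :> \bar R)%E by rewrite lee_fin ler1n.
have cl := Lfun_submod_closed mu p1.
have cl0 : (fun=> 0) \in Lfun mu 2%:E by exact: cl.1.
have clB (a b : R) u v : u \in Lfun mu 2%:E -> v \in Lfun mu 2%:E ->
    (fun x => a * u x + b * v x) \in Lfun mu 2%:E.
  move=> u2 v2; have w2 : b *: v \in Lfun mu 2%:E.
    by rewrite -[b *: v]addr0; exact: cl.2.
  exact: (cl.2 a u (b *: v)).
have clD u v : u \in Lfun mu 2%:E -> v \in Lfun mu 2%:E ->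
    (fun x => u x + v x) \in Lfun mu 2%:E.
  move=> u2 v2; have := clB 1 1 u v u2 v2.
  by under eq_fun do rewrite !mul1r.
split; first by apply/andP; split.
move=> a f g /andP[rf jf] /andP[rg jg]; apply/andP; split.
  rewrite (_ : (fun x => _) = fun x =>
    (complex.Re a * complex.Re (f x) + (- complex.Im a) * complex.Im (f x)) + complex.Re (g x)).
    by apply: clD => //; exact: clB.
  apply/funext => x; change (((a *: f) + g) x) with (a * f x + g x).
  by case: a (f x) (g x) => [? ?] [? ?] [? ?] /=; rewrite mulNr.
rewrite (_ : (fun x => _) = fun x =>
    (complex.Re a * complex.Im (f x) + complex.Im a * complex.Re (f x)) + complex.Im (g x)).
  by apply: clD => //; exact: clB.
apply/funext => x; change (((a *: f) + g) x) with (a * f x + g x).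
by case: a (f x) (g x) => [? ?] [? ?] [? ?] /=.
Qed.

HB.instance Definition _ :=
  GRing.isSubmodClosed.Build _ _ L2pred L2pred_submod_closed.

Record L2fun := MkL2fun { L2fun_val :> T -> R[i]^o ; _ : L2fun_val \in L2pred }.
HB.instance Definition _ := [isSub for L2fun_val].
HB.instance Definition _ := [Choice of L2fun by <:].
HB.instance Definition _ := [SubChoice_isSubLmodule of L2fun by <:].

Definition ae0 : {pred L2fun} := fun f => `[< {ae mu, forall x, f x = 0} >].

Lemma ae0_scale (a : R[i]) (f : L2fun) : f \in ae0 -> a *: f \in ae0.
Proof.
move=> /asboolP f0; apply/asboolP; move: f0; apply: filterS => x fx0.
by change (a * f x = 0); rewrite fx0 mulr0.
Qed.

Lemma ae0_zmod_closed : zmod_closed ae0.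
Proof.
split; first by apply/asboolP; apply/aeW.
move=> f g /asboolP f0 /asboolP g0; apply/asboolP.
move: f0 g0; apply: filterS2 => x fx0 gx0.
by change (f x - g x = 0); rewrite fx0 gx0 subr0.
Qed.

HB.instance Definition _ := GRing.isZmodClosed.Build _ ae0 ae0_zmod_closed.

(* Quotient of the square-integrable functions by the a.e. null ones; its
   complex vector space structure is the quotient structure. *)
Definition L2 : Type := Quotient.quot ae0.
HB.instance Definition _ := GRing.Zmodule.on L2.
HB.instance Definition _ := EqQuotient.on L2.

Definition L2_scale (a : R[i]) (f : L2) : L2 := \pi_L2 (a *: repr f).

Lemma pi_L2_scale a (f : L2fun) : L2_scale a (\pi_L2 f) = \pi_L2 (a *: f).
Proof.
apply/eqP; rewrite /L2_scale -Quotient.idealrBE -scalerBr; apply: ae0_scale.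
by rewrite Quotient.idealrBE reprK.
Qed.

Let scaleA a b (f : L2) : L2_scale a (L2_scale b f) = L2_scale (a * b) f.
Proof. by rewrite {2}/L2_scale pi_L2_scale scalerA. Qed.

Let scale1 : left_id 1 L2_scale.
Proof. by move=> f; rewrite /L2_scale scale1r reprK. Qed.

Lemma pi_L2D (f g : L2fun) : \pi_L2 (f + g) = \pi_L2 f + \pi_L2 g :> L2.
Proof. exact: Quotient.pi_add. Qed.

Let scaleDr : right_distributive L2_scale +%R.
Proof.
move=> a f g; rewrite -[f]reprK -[g]reprK -pi_L2D !pi_L2_scale scalerDr.
exact: pi_L2D.
Qed.

Let scaleDl f : {morph L2_scale^~ f : a b / a + b}.
Proof. by move=> a b; rewrite /L2_scale scalerDl pi_L2D. Qed.

HB.instance Definition _ := GRing.Zmodule_isLmodule.Build R[i] L2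
  scaleA scale1 scaleDr scaleDl.

End L2.

Arguments L2 {d T R} mu.

Section L2_theory.
Context d (T : measurableType d) (R : realType).
Variable mu : {measure set T -> \bar R}.

(* A representative; norm and Fourier coefficients do not depend on it. *)
Definition L2_to_fun (f : L2 mu) : T -> R[i] := (repr f : L2fun mu).

Definition L2norm (f : L2 mu) : R :=
  Num.sqrt (\int[mu]_x (normc (L2_to_fun f x)) ^+ 2).

End L2_theory.

(* Carrier and norm of a normed space sitting inside a vector space V; the
   values of the norm outside the carrier are irrelevant. *)
Record normed_subspace (R : realType) (V : lmodType R[i]) := NormedSubspace {
  carrier : set V;
  nrm : V -> R }.

Section approximation_numbers.
Context (R : realType) (V W : lmodType R[i]).
Variables (X : normed_subspace V) (Y : normed_subspace W).

(* Operators X -> Y are maps V -> W of which only the values on the carrier of X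
   matter. *)
Definition operator_norm (T : V -> W) : \bar R :=
  ereal_sup [set (nrm Y (T f))%:E | f in [set f | carrier X f /\ nrm X f <= 1]].

Definition bounded_operator (T : V -> W) : Prop :=
  [/\ forall f, carrier X f -> carrier Y (T f),
      forall (a : R[i]) f g, carrier X f -> carrier X g ->
        T (a *: f + g) = a *: T f + T g
    & exists C : R, forall f, carrier X f -> nrm Y (T f) <= C * nrm X f].

(* The range of T on X is spanned by fewer than n of its elements. *)
Definition rank_lt (T : V -> W) (n : nat) : Prop :=
  exists m (h : 'I_m -> V),
    [/\ (m < n)%N, forall i, carrier X (h i)
      & forall f, carrier X f ->
          exists c : 'I_m -> R[i], T f = \sum_(i < m) c i *: T (h i)].

(* The infimum is finite for n >= 1 and T bounded (A = 0 competes); fine only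
   casts it to R. *)
Definition approximation_number (n : nat) (T : V -> W) : R :=
  fine (ereal_inf [set operator_norm (fun f => T f - A f) |
    A in [set A | bounded_operator A /\ rank_lt A n]]).

End approximation_numbers.

Section mixed_smoothness.
Context (R : realType) (d : nat).

Definition L2T := L2 (@torus_measure R d).

Definition L2_space : normed_subspace L2T :=
  {| carrier := setT; nrm := @L2norm _ _ _ _ |}.

(* e^{it} *)
Definition expi (t : R) : R[i] := cos t +i* sin t.

Definition torus_integral (g : d.-tuple (measurableTypeR R) -> R[i]) : R[i] :=
  (\int[torus_measure R d]_x complex.Re (g x)) +i*
  (\int[torus_measure R d]_x complex.Im (g x)).

Definition fourier_coef (f : L2T) (k : 'I_d -> int) : R[i] :=
  ((2 * pi) `^ (- (d%:R / 2)))%:C *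
  torus_integral (fun x =>
    L2_to_fun f x * expi (- \sum_(j < d) (k j)%:~R * (tnth x j : R))).

(* Square of the + norm, as a possibly infinite sum over Z^d. *)
Definition Hmix_norm2 (s : R) (f : L2T) : \bar R :=
  \esum_(k in [set: 'I_d -> int])
    (normc (fourier_coef f k) ^+ 2
     * \prod_(j < d) (1 + `|(k j)%:~R| ^+ 2) `^ s)%:E.

Definition Hmix (s : R) : normed_subspace L2T :=
  {| carrier := [set f | (Hmix_norm2 s f < +oo)%E];
     nrm := fun f => Num.sqrt (fine (Hmix_norm2 s f)) |}.

End mixed_smoothness.

(* Main.v *)
(** Let [w k] be the product over [j] of [sqrt (1 + k_j ^ 2)].  The squared norm of [H^s] is
    [sum_k |c_k|^2 w(k)^(2 s)], and Parseval identifies [L_2] with [H^0], so that the embedding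
    is diagonal.  Truncating the Fourier series to the frequencies with [w k <= r] costs at most
    [r^-(s0 - s1)], while any operator of rank smaller than the number [C(r)] of these
    frequencies vanishes at a nonzero trigonometric polynomial supported on them.  Hence
    [a_n <= r^-(s0 - s1)] if [C(r) < n], and [a_n >= r^-(s0 - s1)] if [n <= C(r)], and the limit
    follows from [C(r) ~ 2^d r (ln r)^(d-1) / (d-1)!].

    For the counting function, splitting off one coordinate gives
    [C_(d+1)(r) = sum_(k in Z) C_d(r / sqrt (1 + k^2))], and this summation operator maps
    [x (ln x)^j] to [2 / (j+1) x (ln x)^(j+1) + O(x (1 + ln x)^j)].

    For Parseval, the measurable sets whose indicator is an L^1 limit of trigonometric
    polynomials with values in [0, 1] form a sigma-algebra.  It contains the sets
    [{cos x_j < u}] and [{sin x_j < u}], hence the half-spaces [{x_j > a}] up to null sets, hence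
    all measurable sets; so trigonometric polynomials are dense in L^2. *)
Require Import Defs.
From HB Require Import structures.
From mathcomp Require Import all_boot all_order all_algebra.
From mathcomp Require Import generic_quotient ring_quotient complex ring lra.
From mathcomp Require Import all_classical all_reals all_analysis.
From mathcomp Require Import measurable_realfun.
Set Implicit Arguments.
Unset Strict Implicit.
Unset Printing Implicit Defensive.
Import Order.TTheory GRing.Theory Num.Theory.
Import numFieldNormedType.Exports.
Import Normc.
Local Open Scope classical_set_scope.
Local Open Scope ring_scope.

(** * The counting function of the hyperbolic cross *)

Section counting.
Context {R : realType}.
Implicit Types (F G H : R -> R) (x y : R) (j d m : nat).

(** The counting function is never inverted. With [c = 2^(d+1) / d!] in dimension [d + 1], the
    radius [r = n / (p (ln n)^d)] satisfies [C(r) / n -> c / p]. Hence for large [n] the lower bound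
    on [a_n] applies if [p < c] and the upper one if [p > c]; at this radius the normalised bound is
    exactly [p^s], and [p] may be taken arbitrarily close to [c]. The recursion on the dimension
    starts at one, because the count in dimension zero is an indicator and not [x (ln x)^j] up to
    lower order. The error carries [1 + ln x] because [ln x] vanishes at [x = 1] and could not
    absorb constants there. In the density argument the values in [[0, 1]] serve twice: they make
    products of approximants converge in [L^1], and they turn [L^1] closeness into [L^2] closeness,
    since [t^2 <= t] on [[0, 1]]. Half-spaces have to be recovered from sine and cosine, which
    cannot tell [0] from [2 pi]; hence the null sets. *)

Definition weight1 m : R := Num.sqrt (1 + m%:R ^+ 2).

Lemma weight1_ge m : m%:R <= weight1 m.
Proof. by rewrite -[leLHS]ger0_norm// -sqrtr_sqr ler_sqrt; nra. Qed.

Lemma weight1_le m : weight1 m <= m.+1%:R.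
Proof.
rewrite -[leRHS]ger0_norm// -sqrtr_sqr ler_sqrt ?sqr_ge0//.
have := ler0n R m; rewrite -natr1; nra.
Qed.

Lemma weight1_gt0 m : 0 < weight1 m.
Proof. by rewrite sqrtr_gt0; have := sqr_ge0 (m%:R : R); lra. Qed.

(** The sum of [F (x / sqrt (1 + k ^ 2))] over all integers [k], for [F] vanishing on [x < 1]:
    the omitted terms are zero. *)
Definition lattice_sum F x : R :=
  F x + \sum_(1 <= m < (Num.truncn x).+1) 2 * F (x / weight1 m).

Definition log_term j x : R := if 1 <= x then x * ln x ^+ j else 0.

(** One logarithm is saved over [log_term j] when [j > 0]; for [j = 0] the whole factor [x] is
    saved. Up to the factor 3, [lattice_sum] takes each level of this scale to the next. *)
Definition log_error j x : R :=
  if 1 <= x then (if j is i.+1 then x * (1 + ln x) ^+ i else 1) else 0.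

Lemma log_term_ge0 j x : 0 <= log_term j x.
Proof.
rewrite /log_term; case: ifPn => // x1.
by rewrite mulr_ge0 ?exprn_ge0 ?ln_ge0 ?(le_trans _ x1).
Qed.

Lemma le_log_term j x y : x <= y -> log_term j x <= log_term j y.
Proof.
move=> xy; rewrite {1}/log_term; case: ifPn => x1; last exact: log_term_ge0.
have y1 := le_trans x1 xy; rewrite /log_term y1.
have x0 : 0 < x by lra.
by rewrite ler_pM ?(ltW x0) ?exprn_ge0 ?ln_ge0// lerXn2r ?nnegrE ?ln_ge0// ler_ln// posrE; lra.
Qed.

Lemma le_lattice_sum F G x : (forall y, F y <= G y) -> lattice_sum F x <= lattice_sum G x.
Proof.
by move=> FG; rewrite lerD//; apply: ler_sum => m _; rewrite ler_pM2l.
Qed.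

Lemma lattice_sumB F G x :
  lattice_sum (fun y => F y - G y) x = lattice_sum F x - lattice_sum G x.
Proof.
rewrite /lattice_sum; under eq_bigr do rewrite mulrBr.
by rewrite sumrB; ring.
Qed.

Lemma lattice_sumZ (a : R) F x :
  lattice_sum (fun y => a * F y) x = a * lattice_sum F x.
Proof.
rewrite /lattice_sum mulrDr mulr_sumr; congr (_ + _).
by apply: eq_bigr => m _; ring.
Qed.

Lemma lattice_sum_norm F x : `|lattice_sum F x| <= lattice_sum (fun y => `|F y|) x.
Proof.
apply: (le_trans (ler_normD _ _)); rewrite lerD//.
apply: (le_trans (ler_norm_sum _ _ _)); apply: ler_sum => m _.
by rewrite normrM ger0_norm.
Qed.

(** The difference is [a - b] times the sum of the [j + 1] products [a^(j-i) b^i], each of which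
    lies between [b^j] and [a^j]. It replaces the derivative of [(ln (x / t))^(j+1)] in
    [log_sum_step]. *)
Lemma mean_value_exprS (a b : R) j : 0 <= b <= a ->
  (a - b) * b ^+ j *+ j.+1 <= a ^+ j.+1 - b ^+ j.+1 <= (a - b) * a ^+ j *+ j.+1.
Proof.
move=> /andP[b0 ba]; have a0 := le_trans b0 ba.
have sumc (c : R) : c *+ j.+1 = \sum_(i < j.+1) c by rewrite sumr_const card_ord.
rewrite subrXX -!mulrnAr !sumc; apply/andP; split;
  rewrite ler_wpM2l ?subr_ge0//=; apply: ler_sum => i _ /=;
  have ij : (j = (j - i) + i)%N by rewrite subnK ?leq_ord.
- have -> : b ^+ j = b ^+ (j - i) * b ^+ i by rewrite -exprD -ij.
  by rewrite ler_wpM2r ?exprn_ge0// lerXn2r.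
- have -> : a ^+ j = a ^+ (j - i) * a ^+ i by rewrite -exprD -ij.
  by rewrite ler_wpM2l ?exprn_ge0// lerXn2r.
Qed.

(** Both sides are [ln (1 + t) <= t], taken at [t = 1 / m] and at [t = -1 / (m + 1)]. *)
Lemma ln_succ_bounds m : (0 < m)%N ->
  (m.+1%:R^-1 : R) <= ln (m.+1%:R : R) - ln (m%:R : R) <= m%:R^-1.
Proof.
move=> m0; have mR : 0 < m%:R :> R by rewrite ltr0n.
have nR : 0 < m.+1%:R :> R by rewrite ltr0n.
have e1 : m.+1%:R / m%:R = 1 + m%:R^-1 :> R.
  by rewrite -natr1 mulrDl divff ?gt_eqF// div1r.
have e2 : m%:R / m.+1%:R = 1 + - m.+1%:R^-1 :> R.
  by rewrite -[in LHS](addrK 1 m%:R) natr1 mulrBl divff ?gt_eqF// div1r.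
have i0 : 0 < m%:R^-1 :> R by rewrite invr_gt0.
have k0 : 0 < m.+1%:R^-1 :> R by rewrite invr_gt0.
have l1 : ln (1 + m%:R^-1 : R) <= m%:R^-1 by apply: le_ln1Dx; lra.
have l2 : ln (1 - m.+1%:R^-1 : R) <= - m.+1%:R^-1.
  by apply: le_ln1Dx; rewrite ltrN2 invf_lt1// ltr1n.
by rewrite -e1 ln_div ?posrE// in l1; rewrite -e2 ln_div ?posrE// in l2;
  rewrite lerBlDr in l2; rewrite l1 andbT lerBrDl -lerBrDr addrC.
Qed.

(** For [M = truncn x], a Riemann sum for the integral of [(ln (x / t))^j / t] over [[1, x]], which
    equals [(ln x)^(j+1) / (j+1)]. *)
Definition log_sum j x M : R := \sum_(1 <= m < M.+1) m%:R^-1 * ln (x / m%:R) ^+ j.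

Lemma log_sum_step j x m : (0 < m)%N -> m.+1%:R <= x ->
  m.+1%:R^-1 * ln (x / m.+1%:R) ^+ j *+ j.+1
     <= ln (x / m%:R) ^+ j.+1 - ln (x / m.+1%:R) ^+ j.+1
     <= m%:R^-1 * ln (x / m%:R) ^+ j *+ j.+1.
Proof.
move=> m0 mx; have mR : 0 < m%:R :> R by rewrite ltr0n.
have nR : 0 < m.+1%:R :> R by rewrite ltr0n.
have x0 := lt_le_trans nR mx.
have /andP[d1 d2] := ln_succ_bounds m0.
have b0 : 0 <= ln (x / m.+1%:R) by rewrite ln_ge0// ler_pdivlMr// mul1r.
have e : ln (x / m%:R) - ln (x / m.+1%:R) = ln m.+1%:R - ln m%:R.
  by rewrite !ln_div ?posrE//; ring.
have ba : 0 <= ln (x / m.+1%:R) <= ln (x / m%:R).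
  by rewrite b0/= -subr_ge0 e (le_trans _ d1)// invr_ge0 ltW.
have /andP[h1 h2] := mean_value_exprS j ba; rewrite e in h1 h2.
have a0 : 0 <= ln (x / m%:R) by case/andP: ba; exact: le_trans.
apply/andP; split; [apply: le_trans h1|apply: (le_trans h2)];
  by rewrite lerMn2r ler_wpM2r ?exprn_ge0.
Qed.

(** Telescope [log_sum_step]. The extra [(ln x)^j] above is the term [m = 1]; the [1] lost below
    bounds the end term [(ln (x / M))^(j+1) / (j+1)] at [M = truncn x]. *)
Lemma log_sum_bounds j x : 1 <= x ->
  ln x ^+ j.+1 / j.+1%:R - 1 <= log_sum j x (Num.truncn x) <=
  ln x ^+ j + ln x ^+ j.+1 / j.+1%:R.
Proof.
move=> x1; have x0 : 0 < x by lra.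
have lnx0 : 0 <= ln x by exact: ln_ge0.
have j0 : 0 < j.+1%:R :> R by rewrite ltr0n.
have logS m : log_sum j x m.+1 = log_sum j x m + m.+1%:R^-1 * ln (x / m.+1%:R) ^+ j.
  by rewrite /log_sum big_nat_recr.
have P M : (0 < M)%N -> M%:R <= x ->
    (ln x ^+ j.+1 - ln (x / M%:R) ^+ j.+1) / j.+1%:R <= log_sum j x M <=
    ln x ^+ j + (ln x ^+ j.+1 - ln (x / M%:R) ^+ j.+1) / j.+1%:R.
  (* The increment from [M] to [M + 1] is bounded above by the term of index [M], not [M + 1], so
     the induction carries the lower bound at [M.-1]; the term left out is nonnegative. *)
  have Q : (0 < M)%N -> M%:R <= x ->
      (ln x ^+ j.+1 - ln (x / M%:R) ^+ j.+1) / j.+1%:R <= log_sum j x M.-1 /\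
      log_sum j x M <= ln x ^+ j + (ln x ^+ j.+1 - ln (x / M%:R) ^+ j.+1) / j.+1%:R.
    case: M => // M _; elim: M => [|M IH] Mx.
      rewrite /log_sum big_geq// big_nat1 divr1 invr1 mul1r subrr mul0r addr0.
      by [].
    have [|IH1 IH2] := IH; first by apply: le_trans Mx; rewrite ler_nat.
    have /andP[s1 s2] := log_sum_step j (ltn0Sn M) Mx.
    rewrite -[_ *+ j.+1]mulr_natr -ler_pdivlMr// mulrBl in s1.
    rewrite -[_ *+ j.+1]mulr_natr -ler_pdivrMr// mulrBl in s2.
    rewrite /= in IH1; rewrite mulrBl in IH1; rewrite mulrBl in IH2; rewrite mulrBl.
    rewrite /= (logS M.+1) (logS M).
    rewrite logS in IH2.
    move: s1 s2 IH1 IH2.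
    move: (_ / j.+1%:R) (_ / j.+1%:R) (_ / j.+1%:R) (log_sum j x M) (_^-1 * _) (_^-1 * _).
    by move=> a b c u v w s1 s2 IH1 IH2; split; lra.
  move=> M0 Mx; have [q1 q2] := Q M0 Mx; rewrite q2 andbT (le_trans q1)//.
  case: M M0 Mx {Q q1 q2} => // M _ Mx; rewrite logS lerDl.
  by rewrite mulr_ge0 ?invr_ge0 ?exprn_ge0// ln_ge0// ler_pdivlMr ?mul1r ?ltr0n.
have /andP[t1 t2] := truncn_itv (ltW x0).
have M0 : (0 < Num.truncn x)%N by rewrite truncn_gt0.
have /andP[p1 p2] := P _ M0 t1.
have MR : 0 < (Num.truncn x)%:R :> R by rewrite ltr0n.
have l0 : 0 <= ln (x / (Num.truncn x)%:R) by rewrite ln_ge0// ler_pdivlMr// mul1r.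
(* [x < truncn x + 1 <= 2 truncn x], and [2 <= e]. *)
have l1 : ln (x / (Num.truncn x)%:R) <= 1.
  apply: (@le_trans _ _ (ln (expR 1))); last by rewrite expRK.
  rewrite ler_ln ?posrE ?divr_gt0 ?expR_gt0//.
  rewrite (le_trans _ (expR_ge1Dx 1))// ler_pdivrMr// (le_trans (ltW t2))//.
  rewrite -natr1; have : 1 <= (Num.truncn x)%:R :> R by rewrite ler1n.
  by lra.
apply/andP; split.
- apply: le_trans p1; rewrite mulrBl lerB// ler_pdivrMr// mul1r.
  by rewrite (@le_trans _ _ 1)// ?ler1n// exprn_ile1.
- apply: (le_trans p2); rewrite lerD2l ler_pM2r ?invr_gt0// lerBlDr lerDl exprn_ge0//.
Qed.

Lemma div_nat_ge1 x m : 0 <= x -> (0 < m)%N -> (1 <= x / m%:R) = (m <= Num.truncn x)%N.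
Proof. by move=> x0 m0; rewrite ler_pdivlMr ?ltr0n// mul1r truncn_ge_nat. Qed.

Lemma log_term_sum j x : 1 <= x ->
  \sum_(1 <= m < (Num.truncn x).+1) log_term j (x / m%:R) =
  x * log_sum j x (Num.truncn x).
Proof.
move=> x1; rewrite /log_sum mulr_sumr !big_nat; apply: eq_bigr => m /andP[m1 mM].
by rewrite /log_term div_nat_ge1// ?(le_trans _ x1)// -ltnS mM mulrA.
Qed.

(** For [x >= 1]: if [j = 0], the sum is at most [1 + 2 x <= 3 x]. If [j > 0], replacing [weight1 m]
    by [m] and the inner logarithms by [ln x] leaves the factor [1 + 2 H], with a harmonic sum
    [H <= 1 + ln x] that supplies the new logarithm. *)
Lemma lattice_sum_log_error j x :
  lattice_sum (log_error j) x <= 3 * log_error j.+1 x.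
Proof.
rewrite /lattice_sum; have [x1|x1] := leP 1 x; last first.
  have -> : Num.truncn x = 0%N.
    by apply/eqP; rewrite -leqn0 leqNgt truncn_gt0 -ltNge.
  by rewrite big_geq// /log_error (lt_geF x1) addr0 mulr0.
have x0 : 0 < x by lra.
have lnx0 : 0 <= ln x by exact: ln_ge0.
have M0 : (0 < Num.truncn x)%N by rewrite truncn_gt0.
have /andP[t1 t2] := truncn_itv (ltW x0).
rewrite /log_error x1; case: j => [|j].
  apply: (@le_trans _ _ (1 + \sum_(1 <= m < (Num.truncn x).+1) 2)).
    by rewrite lerD2l; apply: ler_sum => m _; case: ifP => _; lra.
  rewrite big_const_nat subn1 /= iter_addr_0 expr0 mulr1 -mulr_natl.
  by lra.
apply: (@le_trans _ _ (x * (1 + ln x) ^+ j * (1 + 2 * log_sum 0 x (Num.truncn x)))).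
  rewrite mulrDr mulr1 lerD2l /log_sum 2!mulr_sumr !big_nat.
  apply: ler_sum => m /andP[m1 mM].
  have mR : 0 < m%:R :> R by rewrite ltr0n.
  have wx : x / weight1 m <= x / m%:R.
    by rewrite ler_pM2l// lef_pV2 ?posrE ?weight1_gt0// weight1_ge.
  have wx' : x / m%:R <= x by rewrite ler_piMr ?invf_le1 ?ler1n// ltW.
  rewrite mulr1 (mulrC 2) (mulrCA _ 2) (mulrC 2) ler_pM2r//.
  case: ifPn => w1; last by rewrite !mulr_ge0 ?invr_ge0 ?exprn_ge0//; lra.
  rewrite [leRHS]mulrAC; apply: ler_pM => //.
  - by rewrite divr_ge0// ltW// weight1_gt0.
  - by rewrite exprn_ge0// addr_ge0 ?ln_ge0.
  - rewrite lerXn2r ?nnegrE ?addr_ge0 ?ln_ge0// lerD2l ler_ln ?posrE ?divr_gt0 ?weight1_gt0//.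
    exact: le_trans wx'.
have /andP[_ s] := log_sum_bounds 0 x1.
rewrite expr0 expr1 divr1 in s.
have -> : 3 * (x * (1 + ln x) ^+ j.+1) = x * (1 + ln x) ^+ j * (3 * (1 + ln x)).
  by rewrite exprSr; ring.
rewrite ler_wpM2l//.
  by rewrite mulr_ge0 ?exprn_ge0; lra.
lra.
Qed.

(** Since [m <= weight1 m <= m + 1] and [log_term j] is nondecreasing, replacing [weight1 m] by [m]
    changes the sum by at most [log_term j x]. The sum so obtained is [2 x] times [log_sum], known
    up to [2 x (1 + ln x)^j]; together these errors give the constant 3. *)
Lemma lattice_sum_log_term j x :
  `|lattice_sum (log_term j) x - 2 / j.+1%:R * log_term j.+1 x| <= 3 * log_error j.+1 x.
Proof.
have [x1|x1] := leP 1 x; last first.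
  rewrite /lattice_sum; have -> : Num.truncn x = 0%N.
    by apply/eqP; rewrite -leqn0 leqNgt truncn_gt0 -ltNge.
  by rewrite big_geq// /log_error /log_term (lt_geF x1) addr0 !mulr0 subr0 normr0.
have x0 : 0 < x by lra.
have lnx0 : 0 <= ln x by exact: ln_ge0.
have M0 : (0 < Num.truncn x)%N by rewrite truncn_gt0.
have j0 : 0 < j.+1%:R :> R by rewrite ltr0n.
pose S := \sum_(1 <= m < (Num.truncn x).+1) log_term j (x / m%:R).
have U : lattice_sum (log_term j) x <= log_term j x + 2 * S.
  rewrite lerD2l mulr_sumr !big_nat; apply: ler_sum => m /andP[m1 mM].
  rewrite ler_pM2l// le_log_term// ler_pM2l// lef_pV2 ?posrE ?weight1_gt0 ?ltr0n//.
  exact: weight1_ge.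
have L : 2 * S - log_term j x <= lattice_sum (log_term j) x.
  suff : 2 * S - 2 * log_term j x <= \sum_(1 <= m < (Num.truncn x).+1)
      2 * log_term j (x / weight1 m) by rewrite /lattice_sum; lra.
  apply: (@le_trans _ _ (\sum_(1 <= m < (Num.truncn x).+1) 2 * log_term j (x / m.+1%:R))).
    rewrite -mulr_sumr -mulrBr ler_pM2l// lerBlDl /S.
    rewrite big_ltn// divr1 lerD2l big_add1/= [leRHS]big_nat_recr//=.
    by rewrite lerDl log_term_ge0.
  rewrite !big_nat; apply: ler_sum => m /andP[m1 mM].
  rewrite ler_pM2l// le_log_term// ler_pM2l// lef_pV2 ?posrE ?weight1_gt0 ?ltr0n//.
  exact: weight1_le.
rewrite /S log_term_sum// in U L.
have /andP[s1 s2] := log_sum_bounds j x1.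
have T : ln x ^+ j <= (1 + ln x) ^+ j by rewrite lerXn2r ?nnegrE; lra.
have T1 : 1 <= (1 + ln x) ^+ j by rewrite exprn_ege1//; lra.
have -> : 2 / j.+1%:R * log_term j.+1 x = 2 * (x * (ln x ^+ j.+1 / j.+1%:R)).
  by rewrite /log_term x1; field; rewrite nat1r gt_eqF.
have E : log_term j x = x * ln x ^+ j by rewrite /log_term x1.
rewrite E in U L.
rewrite /log_error x1 ler_norml.
move: s1 s2 T T1 U L; move: (_ / j.+1%:R) (ln x ^+ j) (log_sum _ _ _) ((1 + ln x) ^+ j).
move: (lattice_sum _ _) => A W P T' Q s1 s2 T T1 U L.
rewrite -(ler_pM2l x0) in s1; rewrite -(ler_pM2l x0) in s2.
rewrite -(ler_pM2l x0) in T; rewrite -(ler_pM2l x0) in T1.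
by apply/andP; split; lra.
Qed.

(** Dimension zero has a single frequency, whose weight is the empty product 1; hence the initial
    indicator. *)
Definition lattice_count d : R -> R :=
  iter d lattice_sum (fun x => if 1 <= x then 1 else 0).

(** Of the terms [m <= truncn x], all but possibly the last satisfy [weight1 m <= m + 1 <= x], so
    the count is [2 x] up to a bounded error. *)
Lemma lattice_count1 x : `|lattice_count 1 x - 2 * log_term 0 x| <= 3 * log_error 0 x.
Proof.
rewrite /lattice_count /= /lattice_sum /log_term /log_error.
case: (leP 1 x) => x1; last first.
  have -> : Num.truncn x = 0%N.
    by apply/eqP; rewrite -leqn0 leqNgt truncn_gt0 -ltNge.
  by rewrite big_geq// !mulr0 addr0 subr0 normr0.
have x0 : 0 < x by lra.
have M0 : (0 < Num.truncn x)%N by rewrite truncn_gt0.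
have /andP[t1 t2] := truncn_itv (ltW x0).
set s := \sum_(_ <= _ < _) _.
have U : s <= 2 * (Num.truncn x)%:R.
  apply: (@le_trans _ _ (\sum_(1 <= m < (Num.truncn x).+1) 2)).
    by apply: ler_sum => m _; case: ifP => _; lra.
  by rewrite sumr_const_nat subn1 mulr_natr.
have L : 2 * (Num.truncn x).-1%:R <= s.
  rewrite /s -{2}(prednK M0) big_nat_recr ?prednK//=.
  apply: (@le_trans _ _ (\sum_(1 <= m < (Num.truncn x).-1.+1) 2)).
    by rewrite sumr_const_nat subn1 mulr_natr.
  rewrite prednK// -[leLHS]addr0 lerD ?mulr_ge0//; last by case: ifP.
  rewrite !big_nat; apply: ler_sum => m /andP[m1 mM].
  rewrite ifT ?mulr1// ler_pdivlMr ?weight1_gt0// mul1r (le_trans (weight1_le m))//.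
  by rewrite (le_trans _ t1)// ler_nat.
rewrite -natr1 in t2; rewrite -subn1 natrB// in L.
rewrite ler_norml expr0 mulr1; apply/andP; split; lra.
Qed.

(** By linearity of [lattice_sum], the old error contributes [3 K] and the new main term [3 c]. The
    initial 2 and the factors [2 / (j + 1)] multiply up to [2^(d+1) / d!]. *)
Lemma lattice_count_main d : exists K, 0 <= K /\ forall x,
  `|lattice_count d.+1 x - 2 ^+ d.+1 / d`!%:R * log_term d x| <= K * log_error d x.
Proof.
elim: d => [|d [K [K0 IH]]].
  exists 3; split => // x; rewrite expr1 fact0 divr1; exact: lattice_count1.
pose c : R := 2 ^+ d.+1 / d`!%:R.
have c0 : 0 <= c by rewrite divr_ge0 ?exprn_ge0.
exists (3 * K + 3 * c); split => [|x]; first lra.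
have -> : 2 ^+ d.+2 / (d.+1)`!%:R = c * (2 / d.+1%:R) :> R.
  by rewrite /c factS natrM invfM exprS; ring.
have -> : lattice_count d.+2 x - c * (2 / d.+1%:R) * log_term d.+1 x =
  lattice_sum (fun y => lattice_count d.+1 y - c * log_term d y) x +
  c * (lattice_sum (log_term d) x - 2 / d.+1%:R * log_term d.+1 x).
  by rewrite lattice_sumB lattice_sumZ /=; ring.
apply: (le_trans (ler_normD _ _)); rewrite [leRHS]mulrDl lerD//.
- apply: (le_trans (lattice_sum_norm _ _)); apply: (le_trans (le_lattice_sum _ IH)).
  by rewrite lattice_sumZ -[leRHS]mulrA [leRHS]mulrCA ler_wpM2l// lattice_sum_log_error.
- by rewrite normrM ger0_norm// -[leRHS]mulrA [leRHS]mulrCA ler_wpM2l// lattice_sum_log_term.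
Qed.

Lemma cvg_lattice_count d :
  lattice_count d.+1 x / (x * ln x ^+ d) @[x --> +oo] --> (2 ^+ d.+1 / d`!%:R : R).
Proof.
have [K [K0 H]] := lattice_count_main d.
have lny : (ln x : R) @[x --> +oo] --> +oo.
  apply/cvgryPge => A; near=> x.
  rewrite -(expRK A) ler_ln ?posrE ?expR_gt0//.
apply/cvgrPdist_le => e e0; near=> x.
have x1 : 1 <= x by near: x; exact: nbhs_pinfty_ge.
have x0 : 0 < x by lra.
have ln1x : 1 <= ln x by near: x; move/cvgryPge : lny; exact.
have lnx0 : 0 < ln x by lra.
have g0 : 0 < x * ln x ^+ d by rewrite mulr_gt0 ?exprn_gt0.
have := H x; rewrite /log_term x1 => Hx.
rewrite distrC -(ler_pM2r g0) -[X in _ * X <= _](gtr0_norm g0) -normrM mulrBl divfK ?gt_eqF//.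
apply: (le_trans Hx).
(* The error is smaller than the denominator by a factor of order [ln x] if [d > 0], and by [x] if
   [d = 0]. The power of 2 comes from [1 + ln x <= 2 ln x]. *)
have Kx : K * 2 ^+ d <= e * ln x.
  rewrite mulrC -ler_pdivrMl// [X in X <= _]mulrC.
  by near: x; move/cvgryPge : lny; exact.
have Kx' : K <= e * x.
  by rewrite mulrC -ler_pdivrMr//; near: x; exact: nbhs_pinfty_ge.
clear - x1 x0 ln1x lnx0 K0 e0 Kx Kx'.
rewrite /log_error x1; case: d Kx => [_|d Kx]; first by rewrite mulr1 expr0 mulr1.
have h : (1 + ln x) ^+ d <= 2 ^+ d * ln x ^+ d.
  by rewrite -exprMn lerXn2r ?nnegrE//; lra.
have l0 : 0 < ln x ^+ d by rewrite exprn_gt0.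
have p1 : 2 ^+ d.+1 = 2 * 2 ^+ d :> R by rewrite exprS.
have -> : e * (x * ln x ^+ d.+1) = x * ((e * ln x) * ln x ^+ d) by rewrite exprS; ring.
rewrite mulrCA ler_pM2l//.
have p0 : 0 <= 2 ^+ d :> R by rewrite exprn_ge0.
apply: (@le_trans _ _ (K * 2 ^+ d * ln x ^+ d)).
  by rewrite -mulrA ler_wpM2l.
by rewrite ler_pM2r// (le_trans _ Kx)// p1 ler_wpM2l//; lra.
Unshelve. all: by end_near. Qed.

End counting.

(** * Enumeration of the lattice points of the hyperbolic cross *)

Section lattice_points.
Context {R : realType}.

Definition freq_cons d (a : int) (t : 'I_d -> int) : 'I_d.+1 -> int :=
  fun j => if unlift ord0 j is Some i then t i else a.

Lemma freq_cons0 d a (t : 'I_d -> int) : freq_cons a t ord0 = a.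
Proof. by rewrite /freq_cons unlift_none. Qed.

Lemma freq_consS d a (t : 'I_d -> int) i : freq_cons a t (lift ord0 i) = t i.
Proof. by rewrite /freq_cons liftK. Qed.

Lemma freq_consE d (k : 'I_d.+1 -> int) :
  k = freq_cons (k ord0) (fun i => k (lift ord0 i)).
Proof.
apply/funext => j; case: (unliftP ord0 j) => [i ->|->].
  by rewrite freq_consS.
by rewrite freq_cons0.
Qed.

Definition weight d (k : 'I_d -> int) : R := \prod_(j < d) weight1 `|k j|%N.

Lemma weight1_ge1 m : 1 <= weight1 m :> R.
Proof. by rewrite -[leLHS]sqrtr1 ler_sqrt ?lerDl ?sqr_ge0//; have := sqr_ge0 (m%:R : R); lra. Qed.

Lemma weight_ge1 d (k : 'I_d -> int) : 1 <= weight k.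
Proof.
rewrite /weight; elim/big_rec: _ => // j x _ x1.
by rewrite -[leLHS]mulr1 ler_pM// weight1_ge1.
Qed.

Lemma weight_cons d a (t : 'I_d -> int) : weight (freq_cons a t) = weight1 `|a|%N * weight t.
Proof.
rewrite /weight big_ord_recl freq_cons0; congr (_ * _).
by apply: eq_bigr => i _; rewrite freq_consS.
Qed.

(** [Negz m] is [-(m + 1)], hence the two starting indices. Zero stands first and the signs are kept
    apart to match the shape of [lattice_sum]. *)
Definition int_range M : seq int := 0 :: map Posz (iota 1 M) ++ map Negz (iota 0 M).

Lemma int_range_uniq M : uniq (int_range M).
Proof.
rewrite /= cat_uniq !map_inj_uniq ?iota_uniq//=; last 2 first.
- by move=> ? ? [].
- by move=> ? ? [].
rewrite andbT mem_cat negb_or -andbA; apply/and3P; split.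
- by apply/negP => /mapP[m]; rewrite mem_iota => /andP[m0 _] [m00]; rewrite -m00 in m0.
- by apply/negP => /mapP[m].
- by apply/hasPn => a /mapP[m _ ->]; apply/negP => /mapP[].
Qed.

Lemma mem_int_range M a : (`|a| <= M)%N -> a \in int_range M.
Proof.
case: a => [[|m]|m] /= mM; rewrite !inE// mem_cat; apply/orP.
- by right; apply/orP; left; rewrite map_f// mem_iota.
- by right; apply/orP; right; rewrite map_f// mem_iota.
Qed.

(** The recursion copies [lattice_sum], so that the size can be read off. The range for the first
    coordinate [a] is large enough since [|a| <= weight1 |a|] and the other factors of the weight
    are at least 1. *)
Fixpoint lattice_points d (r : R) : seq ('I_d -> int) :=
  match d with
  | 0 => if 1 <= r then [:: fun=> 0] else [::]
  | d'.+1 => [seq freq_cons a t | a <- int_range (Num.truncn r),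
                                  t <- lattice_points d' (r / weight1 `|a|%N)]
  end.

Lemma lattice_pointsS d r : lattice_points d.+1 r =
  [seq freq_cons a t | a <- int_range (Num.truncn r),
                       t <- lattice_points d (r / weight1 `|a|%N)].
Proof. by []. Qed.

Lemma lattice_points_uniq d r : uniq (lattice_points d r).
Proof.
elim: d r => [|d IH] r; first by rewrite /=; case: ifP.
rewrite lattice_pointsS; apply: allpairs_uniq_dep => //; first exact: int_range_uniq.
move=> [a t] [b u] _ _ /= e.
have ab : a = b by move/(congr1 (fun k => k ord0)): e; rewrite !freq_cons0.
rewrite -ab in e *; congr existT; apply/funext => i.
by move/(congr1 (fun k => k (lift ord0 i))): e; rewrite !freq_consS.
Qed.

Lemma mem_lattice_points d r k : (k \in lattice_points d r) = (weight k <= r).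
Proof.
elim: d r k => [|d IH] r k.
  rewrite /= /weight big_ord0; case: ifP => //= r1; rewrite inE.
  by apply/eqP/funext => -[].
rewrite lattice_pointsS; apply/allpairsPdep/idP => [[a [t [_ + ->]]]|wk].
  by rewrite IH weight_cons ler_pdivlMr ?weight1_gt0// mulrC.
rewrite (freq_consE k) weight_cons in wk.
exists (k ord0), (fun i => k (lift ord0 i)); split; last exact: freq_consE.
  apply: mem_int_range; rewrite truncn_ge_nat.
    apply: le_trans wk; apply: (le_trans (weight1_ge _)).
    by rewrite ler_peMr ?weight_ge1// ltW// weight1_gt0.
  by apply: le_trans wk; rewrite mulr_ge0 ?(le_trans ler01)// ?weight_ge1// weight1_ge1.
by rewrite IH ler_pdivlMr ?weight1_gt0// mulrC.
Qed.

Lemma size_lattice_points d r : (size (lattice_points d r))%:R = lattice_count d r :> R.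
Proof.
elim: d r => [|d IH] r; first by rewrite /lattice_count /=; case: ifP.
rewrite lattice_pointsS size_allpairs_dep sumnE big_map big_cons big_cat/= !big_map.
rewrite natrD natrD !natr_sum IH; under eq_bigr do rewrite IH/=.
under [X in _ + (_ + X)]eq_bigr do rewrite IH/=.
rewrite /lattice_count [RHS]/= /lattice_sum -/(lattice_count d).
have -> : weight1 0 = 1 :> R by rewrite /weight1 expr0n addr0 sqrtr1.
rewrite divr1; congr (_ + _).
rewrite -mulr_sumr mulr_natl mulr2n; congr (_ + _).
  by rewrite /index_iota subn1.
rewrite (big_addn 0 _ 1) subn1 /index_iota subn0.
by apply: eq_bigr => i _; rewrite addn1.
Qed.

End lattice_points.

(** * From counting asymptotics to the limit *)

Section asymptotics.
Context {R : realType}.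
Implicit Types (x p c s : R) (d n : nat).

Lemma cvg_ln_pinfty : (ln x : R) @[x --> +oo] --> +oo.
Proof.
apply/cvgryPge => A; near=> x.
by rewrite -(expRK A) ler_ln ?posrE ?expR_gt0.
Unshelve. all: by end_near. Qed.

(** One term of the exponential series gives [(ln x)^(d+1) / (d+1)! <= x], so the quotient is at
    most [(d+1)! / ln x]. *)
Lemma cvg_ln_pow_div d : (ln x ^+ d / x : R) @[x --> +oo] --> 0.
Proof.
apply/cvgr0Pnorm_le => e e0; near=> x.
have x1 : 1 <= x by near: x; exact: nbhs_pinfty_ge.
have lx : (d.+1)`!%:R / e <= ln x by near: x; move/cvgryPge : cvg_ln_pinfty; exact.
have x0 : 0 < x by lra.
have lx0 : 0 <= ln x by rewrite ln_ge0.
rewrite ger0_norm; last by rewrite divr_ge0 ?exprn_ge0// ltW.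
rewrite ler_pdivrMr//.
have f0 : 0 < (d.+1)`!%:R :> R by rewrite ltr0n fact_gt0.
have := expR_ge1Dxn d lx0; rewrite lnK ?posrE// => h.
have {}h : ln x ^+ d.+1 / (d.+1)`!%:R <= x by lra.
rewrite ler_pdivrMr// in lx.
apply: (@le_trans _ _ (e * (ln x ^+ d.+1 / (d.+1)`!%:R))); last by rewrite ler_pM2l.
rewrite mulrA ler_pdivlMr// exprS mulrA [leRHS]mulrC ler_wpM2l ?exprn_ge0//.
by rewrite mulrC.
Unshelve. all: by end_near. Qed.

(** An asymptotic inverse of the counting function in dimension [d + 1]: if [c] is the leading
    constant, the count at this radius is equivalent to [(c / p) x]. *)
Definition radius d p x : R := x / (p * ln x ^+ d).

Lemma cvg_radius d p : 0 < p -> radius d p x @[x --> +oo] --> +oo.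
Proof.
move=> p0; apply/cvgryPge => A; near=> x.
have x0 : 0 < x by near: x; exact: nbhs_pinfty_gt.
have lx0 : 0 < ln x.
  by near: x; move/cvgryPgt : cvg_ln_pinfty; exact.
have l0 : 0 < p * ln x ^+ d by rewrite mulr_gt0 ?exprn_gt0.
have h : ln x ^+ d / x <= (p * (`|A| + 1))^-1.
  near: x; have /cvgr0Pnorm_le := cvg_ln_pow_div d.
  move=> /(_ (p * (`|A| + 1))^-1); rewrite invr_gt0 mulr_gt0 ?ltr_wpDl// => /(_ isT).
  by apply: filterS => y; apply: le_trans; exact: ler_norm.
rewrite ler_pdivrMr// mulrC ler_pdivlMr ?mulr_gt0 ?ltr_wpDl// in h.
rewrite /radius ler_pdivlMr//; apply: le_trans h.
apply: (@le_trans _ _ ((`|A| + 1) * (p * ln x ^+ d))); last first.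
  by rewrite mulrA mulrC (mulrC p).

by rewrite ler_pM2r// (le_trans (ler_norm A))// lerDl.
Unshelve. all: by end_near. Qed.

Lemma cvg_ln_radius d p : 0 < p -> ln (radius d p x) / ln x @[x --> +oo] --> (1 : R).
Proof.
move=> p0; have h1 : (ln x)^-1 @[x --> +oo] --> (0 : R).
  apply/gtr0_cvgV0; last exact: cvg_ln_pinfty.
  by near=> x; near: x; move/cvgryPgt : cvg_ln_pinfty; exact.
have h2 : ln (ln x) ^+ 1 / ln x @[x --> +oo] --> (0 : R).
  exact: (cvg_comp _ _ cvg_ln_pinfty (cvg_ln_pow_div 1)).
have h3 : 1 - ln p * (ln x)^-1 - d%:R * (ln (ln x) ^+ 1 / ln x) @[x --> +oo] --> (1 - ln p * 0 - d%:R * 0 : R).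
  by apply: cvgB; [apply: cvgB; [exact: cvg_cst|apply: cvgM => //; exact: cvg_cst]|apply: cvgM => //; exact: cvg_cst].
rewrite !mulr0 !subr0 in h3; apply: cvg_trans h3; apply: near_eq_cvg; near=> x.
have x0 : 0 < x by near: x; exact: nbhs_pinfty_gt.
have lx0 : 0 < ln x by near: x; move/cvgryPgt : cvg_ln_pinfty; exact.
rewrite /radius ln_div ?posrE ?mulr_gt0 ?exprn_gt0// lnM ?posrE ?exprn_gt0// lnXn//.
by rewrite -mulr_natl expr1; field; rewrite gt_eqF.
Unshelve. all: by end_near. Qed.

Lemma cvg_lattice_count_radius d p : 0 < p ->
  lattice_count d.+1 (radius d p x) / x @[x --> +oo] --> (2 ^+ d.+1 / d`!%:R / p : R).
Proof.
move=> p0; have h1 := cvg_comp _ _ (cvg_radius d p0) (@cvg_lattice_count R d).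
have h2 := cvg_comp _ _ (cvg_ln_radius d p0) (@exprn_continuous R d 1).
have h3 : (lattice_count d.+1 (radius d p x) / (radius d p x * ln (radius d p x) ^+ d)) *
    (ln (radius d p x) / ln x) ^+ d * p^-1 @[x --> +oo] -->
    (2 ^+ d.+1 / d`!%:R * 1 ^+ d * p^-1 : R).
  by apply: cvgM; [exact: cvgM h1 h2|exact: cvg_cst].
rewrite expr1n mulr1 in h3; apply: cvg_trans h3; apply: near_eq_cvg; near=> x.
have x0 : 0 < x by near: x; exact: nbhs_pinfty_gt.
have lx0 : 0 < ln x by near: x; move/cvgryPgt : cvg_ln_pinfty; exact.
have r1 : 1 < radius d p x by near: x; move/cvgryPgt : (cvg_radius d p0); exact.
have lr0 : 0 < ln (radius d p x) by exact: ln_gt0.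
rewrite expr_div_n; have xE : x = radius d p x * (p * ln x ^+ d).
  by rewrite /radius divfK// gt_eqF// mulr_gt0 ?exprn_gt0.
have key (N r lr l : R) : 0 < r -> 0 < lr -> 0 < l ->
    N / (r * lr) * (lr / l) / p = N / (r * (p * l)).
  by move=> *; field; rewrite !gt_eqF.
by rewrite key ?exprn_gt0// -?xE//; lra.
Unshelve. all: by end_near. Qed.

(** At [r = radius d p n] the normalised value of [r^(-s)] is exactly [p^s] ([radiusE]). For large
    [n] the count at this radius is at least [n] if [p < c] and below [n] if [p > c], so [E n] is
    eventually at least, respectively at most, [p^s]. It remains to choose [p^s] within [e] of
    [c^s]. *)
Lemma cvg_approximation_scale d s (a : nat -> R) : 0 < s ->
  (forall n r, (0 < n)%N -> 0 < r -> n%:R <= lattice_count d.+1 r -> r `^ (- s) <= a n) ->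
  (forall n r, (0 < n)%N -> 0 < r -> lattice_count d.+1 r < n%:R -> a n <= r `^ (- s)) ->
  n%:R `^ s * a n / ln n%:R `^ (d%:R * s) @[n --> \oo] --> (2 ^+ d.+1 / d`!%:R) `^ s.
Proof.
move=> s0 alow aup; set c : R := 2 ^+ d.+1 / d`!%:R.
have c0 : 0 < c by rewrite divr_gt0 ?exprn_gt0// ltr0n fact_gt0.
pose E n := n%:R `^ s * a n / ln n%:R `^ (d%:R * s).
have ratio p : 0 < p ->
    lattice_count d.+1 (radius d p n%:R) / n%:R @[n --> \oo] --> c / p.
  by move=> p0; exact: (cvg_comp _ _ (@cvgr_idn R) (@cvg_lattice_count_radius d p p0)).
have lnn : (ln n%:R : R) @[n --> \oo] --> +oo.
  exact: (cvg_comp _ _ (@cvgr_idn R) cvg_ln_pinfty).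
have radiusE p n : 0 < p -> (0 < n)%N -> 0 < ln (n%:R : R) ->
    0 < radius d p n%:R /\
    n%:R `^ s * radius d p n%:R `^ (- s) / ln n%:R `^ (d%:R * s) = p `^ s.
  move=> p0 n0 l0; have nR : 0 < n%:R :> R by rewrite ltr0n.
  have r0 : 0 < radius d p n%:R by rewrite divr_gt0 ?mulr_gt0 ?exprn_gt0.
  have nE : n%:R = p * radius d p n%:R * ln n%:R ^+ d.
    by rewrite /radius; field; rewrite !gt_eqF ?exprn_gt0.
  split=> //; rewrite powRrM powR_mulrn ?(ltW l0)// powRN.
  move: (radius d p n%:R) r0 nE => r r0 nE.
  rewrite {1}nE !powRM ?mulr_ge0 ?exprn_ge0 ?(ltW r0) ?(ltW p0) ?(ltW l0)//.
  have ? : r `^ s != 0 by rewrite gt_eqF// powR_gt0.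
  have ? : (ln n%:R ^+ d) `^ s != 0 by rewrite gt_eqF// powR_gt0// exprn_gt0.
  by rewrite mulrAC mulfK// mulfK.
have geE p : 0 < p < c -> \forall n \near \oo, p `^ s <= E n.
  move=> /andP[p0 pc]; have cp : 1 < c / p by rewrite ltr_pdivlMr// mul1r.
  near=> n.
  have n0 : (0 < n)%N by near: n; exists 1%N.
  have nR : 0 < n%:R :> R by rewrite ltr0n.
  have l0 : 0 < ln (n%:R : R) by near: n; move/cvgryPgt : lnn; exact.
  have [r0 <-] := radiusE p n p0 n0 l0.
  rewrite /E ler_pM2r ?invr_gt0 ?powR_gt0// ler_pM2l ?powR_gt0//.
  apply: alow => //; rewrite -[leLHS]mul1r -ler_pdivlMr//.
  by near: n; exact: (cvgr_ge _ (ratio p p0) _ cp).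
have leE p : c < p -> \forall n \near \oo, E n <= p `^ s.
  move=> pc; have p0 : 0 < p by exact: lt_trans pc.
  have cp : c / p < 1 by rewrite ltr_pdivrMr// mul1r.
  near=> n.
  have n0 : (0 < n)%N by near: n; exists 1%N.
  have nR : 0 < n%:R :> R by rewrite ltr0n.
  have l0 : 0 < ln (n%:R : R) by near: n; move/cvgryPgt : lnn; exact.
  have [r0 <-] := radiusE p n p0 n0 l0.
  rewrite /E ler_pM2r ?invr_gt0 ?powR_gt0// ler_pM2l ?powR_gt0//.
  apply: aup => //; rewrite -[ltRHS]mul1r -ltr_pdivrMr//.
  by near: n; exact: (cvgr_lt _ (ratio p p0) _ cp).
have cs0 : 0 < c `^ s by rewrite powR_gt0.
have root y : 0 <= y -> (y `^ s^-1) `^ s = y.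
  by move=> y0; rewrite -powRrM mulVf ?gt_eqF// powRr1.
have rootc : c = (c `^ s) `^ s^-1 by rewrite -powRrM mulfV ?gt_eqF// powRr1// ltW.
apply/cvgrPdist_le => e e0.
(* [c^s - e] may be negative; the maximum keeps the base of the root positive. *)
pose m := Num.max (c `^ s - e) (c `^ s / 2).
have m0 : 0 < m by rewrite lt_max divr_gt0 ?orbT.
have mE : c `^ s - e <= m by rewrite le_max lexx.
have mc : m < c `^ s by rewrite gt_max; apply/andP; split; lra.
have p1 : 0 < m `^ s^-1 < c.
  rewrite powR_gt0//= [X in _ < X]rootc.
  by apply: gt0_ltr_powR; rewrite ?invr_gt0 ?nnegrE ?(ltW cs0) ?(ltW m0).
have p2 : c < (c `^ s + e) `^ s^-1.
  rewrite [X in X < _]rootc.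
  by apply: gt0_ltr_powR; rewrite ?invr_gt0 ?nnegrE ?addr_ge0 ?(ltW cs0) ?(ltW e0) ?ltrDl.
near=> n.
have h1 : m <= E n.
  by rewrite -[leLHS]root ?(ltW m0)//; near: n; exact: geE.
have h2 : E n <= c `^ s + e.
  by rewrite -[leRHS]root ?addr_ge0 ?(ltW cs0) ?(ltW e0)//; near: n; exact: leE.
by rewrite ler_norml -/(E n); apply/andP; split; lra.
Unshelve. all: by end_near. Qed.
End asymptotics.

(** * Approximation numbers of diagonal embeddings *)

Section esum_seq.
Context {R : realType} {I : choiceType}.
Implicit Types (a : I -> R) (s : seq I).

Lemma le_sum_esum a s : (forall k, 0 <= a k) -> uniq s ->
  ((\sum_(k <- s) a k)%:E <= \esum_(k in [set: I]) (a k)%:E)%E.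
Proof.
move=> a0 us; apply: esum_ge; exists [set` s]; first by split.
by rewrite -fsbig_seq// sumEFin.
Qed.

Lemma esum_le_sum a (x : \bar R) :
  (forall s, uniq s -> ((\sum_(k <- s) a k)%:E <= x)%E) ->
  (\esum_(k in [set: I]) (a k)%:E <= x)%E.
Proof.
move=> ax; apply: ge_ereal_sup => _ [X [finX _] <-].
by rewrite fsbig_finite//= sumEFin ax.
Qed.

Lemma esum_seq a s : (forall k, 0 <= a k) -> uniq s ->
  (forall k, k \notin s -> a k = 0) ->
  \esum_(k in [set: I]) (a k)%:E = (\sum_(k <- s) a k)%:E.
Proof.
move=> a0 us as0; apply/eqP; rewrite eq_le le_sum_esum// andbT.
apply: esum_le_sum => t ut; rewrite lee_fin.
rewrite (bigID (mem s))/= [X in _ + X]big1 ?addr0; last by move=> k; exact: as0.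
rewrite -[leLHS]big_filter (perm_big [seq k <- s | k \in t])/=; last first.
  by apply: uniq_perm; rewrite ?filter_uniq// => k; rewrite !mem_filter andbC.
by rewrite big_filter [leRHS](bigID (mem t))/= lerDl; exact: sumr_ge0.
Qed.

Lemma le_esum_scale (b : R) a a' : 0 <= b -> (forall k, 0 <= a' k) ->
  (forall k, a k <= b * a' k) ->
  (\esum_(k in [set: I]) (a k)%:E <= b%:E * \esum_(k in [set: I]) (a' k)%:E)%E.
Proof.
move=> b0 a0 aa'; apply: esum_le_sum => s us.
apply: (@le_trans _ _ (b%:E * (\sum_(k <- s) a' k)%:E)%E).
  by rewrite -EFinM lee_fin mulr_sumr; exact: ler_sum.
by rewrite lee_wpmul2l ?lee_fin// le_sum_esum.
Qed.

End esum_seq.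

Lemma normc_nneg (R : realType) (z : complex R) : 0 <= normc z.
Proof. by case: z => x y; exact: sqrtr_ge0. Qed.

Section weighted_embedding.
Local Open Scope complex_scope.
Context (R : realType) (V : lmodType R[i]) (I : choiceType).
Variables (coef : V -> I -> R[i]) (basis : I -> V) (W : I -> R).
Hypothesis coef_linear : forall (a : R[i]) f g k,
  coef (a *: f + g) k = a * coef f k + coef g k.
Hypothesis coef_basis : forall k l, coef (basis k) l = (k == l)%:R.
Hypothesis W_ge1 : forall k, 1 <= W k.

(** [W] stands for the square of [weight], so the exponent is [s] and not [2 s]. *)
Definition wnorm2 (s : R) (f : V) : \bar R :=
  \esum_(k in [set: I]) (normc (coef f k) ^+ 2 * W k `^ s)%:E.

Definition wspace (s : R) : normed_subspace V :=
  {| carrier := [set f | (wnorm2 s f < +oo)%E];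
     nrm := fun f => Num.sqrt (fine (wnorm2 s f)) |}.

Lemma wterm_ge0 s f k : 0 <= normc (coef f k) ^+ 2 * W k `^ s.
Proof. by rewrite mulr_ge0 ?sqr_ge0 ?powR_ge0. Qed.

Lemma wnorm2_ge0 s f : (0 <= wnorm2 s f)%E.
Proof. by apply: esum_ge0 => k _; rewrite lee_fin wterm_ge0. Qed.

Lemma coef0 k : coef 0 k = 0.
Proof.
by have := coef_linear (-1) 0 0 k; rewrite scaler0 addr0 mulN1r addNr.
Qed.

Lemma coefZ a f k : coef (a *: f) k = a * coef f k.
Proof. by rewrite -[a *: f]addr0 coef_linear coef0 addr0. Qed.

Lemma coefD f g k : coef (f + g) k = coef f k + coef g k.
Proof. by rewrite -[f in LHS]scale1r coef_linear mul1r. Qed.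

Lemma coefB f g k : coef (f - g) k = coef f k - coef g k.
Proof. by rewrite coefD -scaleN1r coefZ mulN1r. Qed.

Lemma coef_sum (J : Type) (r : seq J) (F : J -> V) k :
  coef (\sum_(j <- r) F j) k = \sum_(j <- r) coef (F j) k.
Proof.
by elim/big_rec2: _ => [|j y x _ <-]; rewrite ?coef0 ?coefD.
Qed.

Definition partial_sum (s : seq I) (f : V) : V := \sum_(k <- s) coef f k *: basis k.

Lemma coef_partial_sum s f k : uniq s ->
  coef (partial_sum s f) k = if k \in s then coef f k else 0.
Proof.
move=> us; rewrite /partial_sum coef_sum.
under eq_bigr do rewrite coefZ coef_basis mulr_natr mulrb.
rewrite -big_mkcond/=; case: ifPn => ks.
  by rewrite -big_filter (filter_pred1_uniq us ks) big_seq1.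
rewrite big_seq_cond big1// => l /andP[ls /eqP lk].
by rewrite -lk ls in ks.
Qed.

Lemma wnorm2_seq s f (t : seq I) : uniq t -> (forall k, k \notin t -> coef f k = 0) ->
  wnorm2 s f = (\sum_(k <- t) normc (coef f k) ^+ 2 * W k `^ s)%:E.
Proof.
move=> ut ft; apply: esum_seq => // [k|k /ft ->]; first exact: wterm_ge0.
by rewrite normc0 expr0n mul0r.
Qed.

Lemma wspace_basis s k : carrier (wspace s) (basis k).
Proof.
rewrite /= (@wnorm2_seq _ _ [:: k])// ?ltry// => l; rewrite inE => lk.
by rewrite coef_basis eq_sym (negbTE lk).
Qed.

Lemma operator_norm_scale s0 s1 (T : V -> V) (b : R) : 0 <= b ->
  (forall f, wnorm2 s1 (T f) <= (b ^+ 2)%:E * wnorm2 s0 f)%E ->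
  (forall f, carrier (wspace s0) f -> carrier (wspace s1) (T f)) /\
  (forall f, carrier (wspace s0) f -> nrm (wspace s1) (T f) <= b * nrm (wspace s0) f).
Proof.
move=> b0 H; have fin f : carrier (wspace s0) f -> wnorm2 s0 f \is a fin_num.
  by move=> /= f0; rewrite ge0_fin_numE// wnorm2_ge0.
have finT f : carrier (wspace s0) f -> (wnorm2 s1 (T f) < +oo)%E.
  move=> f0; apply: (le_lt_trans (H f)).
  by rewrite -(fineK (fin f f0)) -EFinM ltry.
split; first exact: finT.
move=> f f0 /=; rewrite -[X in X * _](ger0_norm b0) -sqrtr_sqr -sqrtrM ?sqr_ge0//.
rewrite ler_sqrt ?mulr_ge0 ?sqr_ge0 ?fine_ge0 ?wnorm2_ge0//.
have Tfin : wnorm2 s1 (T f) \is a fin_num.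
  by rewrite ge0_fin_numE ?wnorm2_ge0// finT.
by rewrite -lee_fin EFinM !fineK// fin.
Qed.

(** The infimum before [fine] is applied: [fine] sends infinite values to 0, so a lower bound passes
    to [approximation_number] only once finiteness is known. *)
Definition approximation_ereal (s0 s1 : R) n : \bar R :=
  ereal_inf [set operator_norm (wspace s0) (wspace s1) (fun f => idfun f - A f) |
    A in [set A | bounded_operator (wspace s0) (wspace s1) A /\ rank_lt (wspace s0) A n]].

(** The competitor is the truncation to [s]; what remains is diagonal, zero on [s], and [hW] bounds
    it off [s]. *)
Lemma approximation_upper (s0 s1 b : R) (s : seq I) n : uniq s -> s1 <= s0 -> 0 <= b ->
  (size s < n)%N ->
  (forall k, k \notin s -> W k `^ s1 <= b ^+ 2 * W k `^ s0) ->
  (approximation_ereal s0 s1 n <= b%:E)%E.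
Proof.
move=> us s10 b0 sn hW; pose T f := idfun f - partial_sum s f.
have TH f : (wnorm2 s1 (T f) <= (b ^+ 2)%:E * wnorm2 s0 f)%E.
  apply: le_esum_scale => [|k|k]; rewrite ?sqr_ge0 ?wterm_ge0//.
  rewrite /T coefB coef_partial_sum//; case: ifPn => ks.
    by rewrite subrr normc0 expr0n mul0r mulr_ge0 ?sqr_ge0 ?wterm_ge0.
  by rewrite subr0 mulrCA ler_wpM2l ?sqr_ge0// hW.
(* The competitor itself has to be bounded; the constant 1 works because [W >= 1] and [s1 <= s0]. *)
have PH f : (wnorm2 s1 (partial_sum s f) <= (1 ^+ 2)%:E * wnorm2 s0 f)%E.
  apply: le_esum_scale => [|k|k]; rewrite ?sqr_ge0 ?wterm_ge0// expr1n mul1r.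
  rewrite coef_partial_sum//; case: ifPn => ks; last first.
    by rewrite normc0 expr0n mul0r wterm_ge0.
  by rewrite ler_wpM2l ?sqr_ge0// ler_powR.
have [Tc Tn] := operator_norm_scale b0 TH.
have [Pc Pn] := operator_norm_scale ler01 PH.
apply: (@le_trans _ _ (operator_norm (wspace s0) (wspace s1) T)).
  apply: ereal_inf_lbound; exists (partial_sum s) => //; split.
    split => //; last by exists 1.
    move=> a f g _ _; rewrite /partial_sum scaler_sumr -big_split/=.
    by apply: eq_bigr => k _; rewrite coef_linear scalerDl scalerA.
  (* [rank_lt] asks for a span of images, and each [basis k] with [k] in [s] is its own image under
     the truncation. *)
  exists (size s), (fun i => basis (tnth (in_tuple s) i)).
  split => // [i|f f0]; first exact: wspace_basis.
  exists (fun i => coef f (tnth (in_tuple s) i)).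
  rewrite {1}/partial_sum (big_tnth _ _ s); apply: eq_bigr => i _; congr (_ *: _).
  rewrite /partial_sum (bigD1_seq (tnth (in_tuple s) i)) ?mem_tnth//=.
  rewrite coef_basis eqxx scale1r big1 ?addr0// => k ki.
  by rewrite coef_basis eq_sym (negbTE ki) scale0r.
apply: ge_ereal_sup => _ [f [fc f1] <-]; rewrite lee_fin.
by rewrite (le_trans (Tn f fc))// ler_piMr.
Qed.

Lemma approximation_lower (s0 s1 b : R) (s : seq I) n : uniq s -> 0 <= b ->
  (n <= size s)%N ->
  (forall k, k \in s -> b ^+ 2 * W k `^ s0 <= W k `^ s1) ->
  (b%:E <= approximation_ereal s0 s1 n)%E.
Proof.
(* [rank A < size s], so [A] kills a nonzero combination of the [basis k], [k \in s]. *)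
move=> us b0 sn hW; apply: le_ereal_inf_tmp => _ [A [[Ac Alin _] [m [h [mn hc hA]]]] <-].
set N := size s in sn *; pose e (i : 'I_N) := basis (tnth (in_tuple s) i).
have /choice[C hC] i : exists c : 'I_m -> R[i], A (e i) = \sum_(j < m) c j *: A (h j).
  by apply: hA; exact: wspace_basis.
pose M : 'M[R[i]]_(N, m) := \matrix_(i, j) C i j.
have /rowV0Pn[u uM u0] : kermx M != 0.
  rewrite -mxrank_eq0 mxrank_ker subn_eq0 -ltnNge.
  by rewrite (leq_ltn_trans (rank_leq_col M))// (leq_trans mn).
have {}uM : u *m M = 0 by apply/sub_kermxP.
pose q := \sum_(i < N) normc (u 0 i) ^+ 2 * W (tnth (in_tuple s) i) `^ s0.
have W0 k t : 0 < W k `^ t by rewrite powR_gt0// (lt_le_trans _ (W_ge1 k)).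
have q0 : 0 < q.
  rewrite lt_neqAle sumr_ge0 ?andbT; last by move=> i _; rewrite mulr_ge0 ?sqr_ge0 ?powR_ge0.
  rewrite eq_sym psumr_neq0; last by move=> i _; rewrite mulr_ge0 ?sqr_ge0 ?powR_ge0.
  have /rV0Pn[i ui] := u0; apply/hasP; exists i; rewrite ?mem_index_enum//=.
  rewrite mulr_gt0// exprn_gt0// lt_neqAle normc_nneg andbT eq_sym.
  by apply: contra ui => /eqP/eq0_normc ->.
(* This factor gives the test element [f] below norm one in [wspace s0]. *)
pose a : R[i] := ((Num.sqrt q)^-1)%:C.
have a2 : normc a ^+ 2 = q^-1.
  by rewrite /normc/= expr0n addr0 sqr_sqrtr ?sqr_ge0// exprVn sqr_sqrtr// ltW.
(* [A] is linear only on the carrier, so its value at [f] is computed by induction over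
   subcombinations, each of which must be shown to lie there. *)
pose F (r : seq 'I_N) := \sum_(i <- r) (a * u 0 i) *: e i.
have coefF r k : k \notin s -> coef (F r) k = 0.
  move=> ks; rewrite coef_sum big1// => i _; rewrite coefZ coef_basis.
  have [ik|_] := eqVneq; last by rewrite mulr0.
  by rewrite -ik mem_tnth in ks.
have F_fin r t : (wnorm2 t (F r) < +oo)%E.
  by rewrite (@wnorm2_seq _ _ s)// ?ltry// => k; exact: coefF.
have AF r : A (F r) = \sum_(i <- r) (a * u 0 i) *: A (e i).
  elim: r => [|i r IH].
    rewrite /F !big_nil.
    have z0 : carrier (wspace s0) 0 by have := F_fin [::] s0; rewrite /F big_nil.
    by have := Alin (-1) _ _ z0 z0; rewrite scaler0 addr0 scaleN1r addNr.
  by rewrite /F !big_cons Alin ?IH//; [exact: wspace_basis|exact: F_fin].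
pose f := F (index_enum 'I_N).
have Af : A f = 0.
  rewrite AF; under eq_bigr do rewrite hC scaler_sumr.
  rewrite exchange_big big1//= => j _.
  under eq_bigr do rewrite scalerA -mulrA.
  rewrite -scaler_suml -mulr_sumr; have := congr1 (fun v : 'rV[R[i]]_m => v 0 j) uM.
  rewrite !mxE; under eq_bigr do rewrite mxE.
  by move=> ->; rewrite mulr0 scale0r.
have coeff i : coef f (tnth (in_tuple s) i) = a * u 0 i.
  rewrite coef_sum (bigD1 i)//= coefZ coef_basis eqxx mulr1 big1 ?addr0// => j ji.
  rewrite coefZ coef_basis (_ : _ == _ = false) ?mulr0//.
  apply/negbTE; apply: contra ji => /eqP ij; apply/eqP.
  by have /tuple_uniqP inj := (us : uniq (in_tuple s)); apply: inj.
have wf t : wnorm2 t f = (q^-1 * \sum_(i < N) normc (u 0 i) ^+ 2 * W (tnth (in_tuple s) i) `^ t)%:E.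
  rewrite (@wnorm2_seq _ _ s)//; last by move=> k; exact: coefF.
  rewrite big_tnth mulr_sumr; congr (_%:E); apply: eq_bigr => i _.
  by rewrite coeff normcM exprMn a2 -mulrA.
apply: (@le_trans _ _ (nrm (wspace s1) (idfun f - A f))%:E); last first.
  apply: ereal_sup_ubound; exists f => //; split; first exact: F_fin.
  by rewrite /= wf -/q mulVf ?gt_eqF// sqrtr1.
rewrite lee_fin Af subr0 /= wf /= -[leLHS](ger0_norm b0) -sqrtr_sqr ler_sqrt; last first.
  rewrite mulr_ge0 ?invr_ge0 ?(ltW q0)// sumr_ge0// => i _.
  by rewrite mulr_ge0 ?sqr_ge0 ?powR_ge0.
rewrite ler_pdivlMl// mulrC mulr_sumr; apply: ler_sum => i _.
by rewrite mulrCA ler_wpM2l ?sqr_ge0// hW// mem_tnth.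
Qed.

(** * Finite spans and Parseval's identity *)

Definition in_span (f : V) : Prop := exists2 s : seq I, uniq s & partial_sum s f = f.

Lemma in_span_coef s f : uniq s -> partial_sum s f = f ->
  forall k, k \notin s -> coef f k = 0.
Proof.
by move=> us sf k ks; rewrite -sf coef_partial_sum// (negbTE ks).
Qed.

Lemma partial_sum_widen s t f : uniq s -> uniq t -> {subset s <= t} ->
  partial_sum s f = f -> partial_sum t f = f.
Proof.
move=> us ut st sf; rewrite -[RHS]sf /partial_sum (bigID (mem s))/=.
rewrite [X in _ + X]big1 ?addr0; last first.
  by move=> k ks; rewrite (in_span_coef us sf ks) scale0r.
rewrite -big_filter; apply: perm_big; apply: uniq_perm; rewrite ?filter_uniq// => k.
by rewrite mem_filter; case: (boolP (k \in s)) => //= /st.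
Qed.

Lemma partial_sum_linear s a b f g :
  partial_sum s (a *: f + b *: g) = a *: partial_sum s f + b *: partial_sum s g.
Proof.
rewrite /partial_sum !scaler_sumr -big_split; apply: eq_bigr => k _ /=.
by rewrite coefD !coefZ scalerDl !scalerA.
Qed.

Lemma in_span_lin a b f g : in_span f -> in_span g -> in_span (a *: f + b *: g).
Proof.
move=> [s us sf] [t ut tg]; exists (undup (s ++ t)); first exact: undup_uniq.
rewrite partial_sum_linear; congr (_ *: _ + _ *: _);
  [apply: partial_sum_widen sf|apply: partial_sum_widen tg];
  rewrite ?undup_uniq// => k ks; by rewrite mem_undup mem_cat ks ?orbT.
Qed.

Lemma in_span_basis a k : in_span (a *: basis k).
Proof.
exists [:: k] => //; rewrite /partial_sum big_seq1 coefZ coef_basis eqxx.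
by rewrite mulr1.
Qed.

Section parseval.
Variable N : V -> R.
Hypothesis N_ge0 : forall f, 0 <= N f.
Hypothesis N_step : forall f k,
  N (f - coef f k *: basis k) = N f - normc (coef f k) ^+ 2.
Hypothesis span_dense : forall f (e : R), 0 < e -> exists2 g, in_span g & N (f - g) < e.

(** Iterate [N_step]: subtracting the terms of [s] leaves the coefficient at a new index
    unchanged. *)
Lemma sqnorm_partial_sum s f : uniq s ->
  N (f - partial_sum s f) = N f - \sum_(k <- s) normc (coef f k) ^+ 2.
Proof.
elim: s => [|k s IH] /=; first by rewrite /partial_sum !big_nil !subr0.
move=> /andP[ks us]; rewrite {1}/partial_sum !big_cons -/(partial_sum s f).
have ck : coef (f - partial_sum s f) k = coef f k.
  by rewrite coefB coef_partial_sum// (negbTE ks) subr0.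
rewrite opprD addrA addrAC -{1}ck N_step ck IH//; ring.
Qed.

(** One inequality is Bessel's, from [N_ge0]. For the other, take [g] in the span close to [f], with
    support in [s]; as [g] is fixed by the partial sum over [s], the remainder of [f] equals that of
    [f - g], whose squared norm is at most [N (f - g)]. *)
Lemma parseval f : wnorm2 0 f = (N f)%:E.
Proof.
apply/eqP; rewrite eq_le; apply/andP; split.
  apply: esum_le_sum => s us; rewrite lee_fin -subr_ge0.
  under eq_bigr do rewrite powRr0 mulr1.
  by rewrite -sqnorm_partial_sum.
apply/lee_addgt0Pr => e e0; have [g [s us sg] fg] := span_dense f e0.
have sE : f - partial_sum s f = (f - g) - partial_sum s (f - g).
  have := partial_sum_linear s 1 (-1) f g; rewrite !scale1r !scaleN1r sg => ->.
  by rewrite opprB addrA subrK.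
have h : N f <= \sum_(k <- s) normc (coef f k) ^+ 2 + e.
  rewrite -lerBlDl -sqnorm_partial_sum// sE sqnorm_partial_sum//.
  rewrite (le_trans _ (ltW fg))// gerBl sumr_ge0// => k _; exact: sqr_ge0.
apply: (@le_trans _ _ ((\sum_(k <- s) normc (coef f k) ^+ 2)%:E + e%:E)%E).
  by rewrite -EFinD lee_fin.
rewrite leeD2r//.
apply: le_trans (le_sum_esum _ us); last by move=> k; exact: wterm_ge0.
by rewrite lee_fin; apply: ler_sum => k _; rewrite powRr0 mulr1.
Qed.
End parseval.

End weighted_embedding.

(** * Integration on the torus *)

Section circle_integral.
Local Open Scope complex_scope.
Context (R : realType).
Implicit Types (f : R -> R) (k : int) (M : R).

Lemma circle_measureE (A : set (measurableTypeR R)) :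
  @circle_measure R A = lebesgue_measure (A `&` @circle R).
Proof. by []. Qed.

Lemma pi2_gt0 : 0 < 2 * pi :> R.
Proof. by rewrite mulr_gt0// pi_gt0. Qed.

Lemma circle_measureT : @circle_measure R setT = (2 * pi)%:E.
Proof.
by rewrite circle_measureE setTI lebesgue_measure_itv/= lte_fin pi2_gt0 oppr0 adde0.
Qed.

Lemma bounded_integrable d (T : measurableType d) (mu : {finite_measure set T -> \bar R})
    (f : T -> R) (M : R) : measurable_fun setT f -> (forall x, `|f x| <= M) ->
  mu.-integrable setT (EFin \o f).
Proof.
move=> mf fM; apply: measurable_bounded_integrable => //.
  by rewrite ltey_eq fin_num_measure.
exists M; split; first exact: num_real.
by move=> x Mx y _ /=; apply: (le_trans (fM y)); exact: ltW.
Qed.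

Lemma circle_Rintegral f M : measurable_fun setT f -> (forall x, `|f x| <= M) ->
  \int[@circle_measure R]_x f x = \int[lebesgue_measure]_(x in `[0, 2 * pi]) f x.
Proof.
move=> mf fM; rewrite /Rintegral; congr fine.
rewrite (@negligible_integral _ _ _ (@circle_measure R) setT (~` @circle R) (fun x => (f x)%:E)) //; last 3 first.
- by apply: measurableC; exact: (@measurable_circle R).
- exact: (@bounded_integrable _ _ (@circle_measure R) _ _ mf fM).
- by rewrite -[LHS]/(lebesgue_measure (~` @circle R `&` @circle R)) setICl measure0.
rewrite setDE setTI setCK; apply: (eq_measure_integral (@lebesgue_measure R)) => A mA AC.
by rewrite -[LHS]/(lebesgue_measure (A `&` @circle R)) setIidl.
Qed.

Lemma sin_intmul2pi k : sin (k%:~R * (2 * pi)) = 0 :> R.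
Proof.
have h (n : nat) : sin (n%:R * (2 * pi)) = 0 :> R.
  have := periodicn (@sinD2pi R) n 0; by rewrite sin0 add0r -[pi *+ 2]mulr_natl -[_ *+ n]mulr_natl.
case: k => n; first exact: h.
by rewrite NegzE mulrNz mulNr sinN h oppr0.
Qed.

Lemma cos_intmul2pi k : cos (k%:~R * (2 * pi)) = 1 :> R.
Proof.
have h (n : nat) : cos (n%:R * (2 * pi)) = 1 :> R.
  have := periodicn (@cosD2pi R) n 0; by rewrite cos0 add0r -[pi *+ 2]mulr_natl -[_ *+ n]mulr_natl.
case: k => n; first exact: h.
by rewrite NegzE mulrNz mulNr cosN h.
Qed.

Lemma continuous_sinZ (a : R) : continuous (fun x : R => sin (a * x)).
Proof.
move=> x; apply: continuous_comp; last exact: continuous_sin.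
exact: mulrl_continuous.
Qed.

Lemma continuous_cosZ (a : R) : continuous (fun x : R => cos (a * x)).
Proof.
move=> x; apply: continuous_comp; last exact: continuous_cos.
exact: mulrl_continuous.
Qed.

Lemma is_derive_trigZ (a : R) (g dg : R -> R) : a != 0 ->
  (forall x : R, is_derive x 1 g (dg x)) ->
  forall x : R, is_derive x 1 (fun y : R => a^-1 * g (a * y)) (dg (a * x)).
Proof.
move=> a0 gdg x.
have h1 : is_derive x 1 (a \*: (@idfun R)) (a *: 1) by exact: is_deriveZ.
have h2 := is_derive1_comp (gdg (a *: x)) h1.
have h3 := is_deriveZ a^-1 h2; apply: is_derive_eq h3 _.
by rewrite /GRing.scale/=; field.
Qed.

(** The fundamental theorem of calculus for the primitive [g (a x) / a]; it serves both sine and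
    cosine. *)
Lemma circle_integral_deriv (a : R) (g dg : R -> R) M : a != 0 ->
  (forall x : R, is_derive x 1 g (dg x)) -> continuous dg ->
  (forall x, `|dg x| <= M) ->
  \int[@circle_measure R]_x dg (a * x) = a^-1 * (g (a * (2 * pi)) - g 0).
Proof.
move=> a0 gdg cdg dgM.
have cdga : continuous (fun x => dg (a * x)).
  move=> x; apply: continuous_comp; last exact: cdg.
  exact: mulrl_continuous.
have gd := is_derive_trigZ a0 gdg.
rewrite (@circle_Rintegral _ M)//; last by apply: continuous_measurable_fun; exact: cdga.
rewrite /Rintegral (@continuous_FTC2 _ _ (fun x => a^-1 * g (a * x)))//.
- by rewrite /= mulr0 mulrBr.
- exact: pi2_gt0.
- exact: continuous_subspaceT.
- have cg x : {for x, continuous (fun x => a^-1 * g (a * x))}.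
    by apply/differentiable_continuous/derivable1_diffP; exact: (@ex_derive _ _ _ _ _ _ _ (gd x)).
  split => [x _||].
  + exact: (@ex_derive _ _ _ _ _ _ _ (gd x)).
  + exact/cvg_at_right_filter/cg.
  + exact/cvg_at_left_filter/cg.
- by move=> x _; rewrite derive1E; exact: (@derive_val _ _ _ _ _ _ _ (gd x)).
Qed.

Lemma circle_integral_cos k : \int[@circle_measure R]_x cos (k%:~R * x) =
  if k == 0 then 2 * pi else 0.
Proof.
have [->|k0] := eqVneq k 0.
  under eq_Rintegral do rewrite mul0r cos0.
  by rewrite Rintegral_cst// [X in fine X]circle_measureT mul1r.
rewrite (@circle_integral_deriv _ sin cos 1) ?intr_eq0//; last 2 first.
- exact: continuous_cos.
- exact: cos_max.
by rewrite sin_intmul2pi sin0 subrr mulr0.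
Qed.

Lemma circle_integral_sin k : \int[@circle_measure R]_x sin (k%:~R * x) = 0.
Proof.
have [->|k0] := eqVneq k 0.
  under eq_Rintegral do rewrite mul0r sin0.
  by rewrite Rintegral_cst// mul0r.
have kR : k%:~R != 0 :> R by rewrite intr_eq0.
have dcos (x : R) : is_derive x 1 (- cos) (sin x).
  by rewrite -[sin x]opprK; apply: is_deriveN.
rewrite (circle_integral_deriv kR dcos (@continuous_sin R) (@sin_max R)).
by rewrite /= !fctE cos_intmul2pi cos0 subrr mulr0.
Qed.
End circle_integral.

(** * Product integrals over the torus *)

Section torus_integral.
Local Open Scope complex_scope.
Context (R : realType).
Notation point n := (n.-tuple (measurableTypeR R)).

Lemma measurable_coord n (j : 'I_n) : measurable_fun setT (fun x : point n => tnth x j : R).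
Proof. exact: measurable_tnth. Qed.

Lemma torus_measureSE n (A : set (point n.+1)) : measurable A ->
  @torus_measure R n.+1 A =
  (@circle_measure R \x @torus_measure R n)%E (@consT R n @^-1` A).
Proof. by []. Qed.

(** Change of variables along [consT], then Fubini; boundedness on a finite measure space provides
    integrability. *)
Lemma torus_Rintegral_rec n (a : R -> R) (b : point n -> R) (Ma Mb : R) :
  measurable_fun setT a -> (forall x, `|a x| <= Ma) ->
  measurable_fun setT b -> (forall x, `|b x| <= Mb) ->
  \int[@torus_measure R n.+1]_x (a (thead x) * b [tuple of behead x]) =
  (\int[@circle_measure R]_x a x) * (\int[@torus_measure R n]_x b x).
Proof.
move=> ma aM mb bM.
pose f (x : point n.+1) := a (thead x) * b [tuple of behead x].
have mf : measurable_fun setT f.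
  apply: measurable_funM.
    apply: measurableT_comp => //; exact: measurable_tnth.
  by apply: measurableT_comp => //; exact: measurable_behead.
pose g (z : measurableTypeR R * point n) := a z.1 * b z.2.
have gf z : f (consT z) = g z.
  rewrite /f /g /consT theadE; congr (_ * b _).
  by apply: val_inj.
have mg : measurable_fun setT g.
  by apply: measurable_funM; apply: measurableT_comp.
have gM z : `|g z| <= Ma * Mb.
  by rewrite normrM ler_pM.
pose P := (@circle_measure R \x @torus_measure R n)%E.
have fin : P setT \is a fin_num.
  rewrite /P -setXTT product_measure1E//.
  by rewrite fin_numM// fin_num_measure.
have ig : P.-integrable setT (EFin \o g).
  apply: measurable_bounded_integrable => //; first by rewrite ltey_eq fin.
  exists (Ma * Mb); split; first exact: num_real.
  by move=> x Mx y _ /=; apply: (le_trans (gM y)); exact: ltW.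
have ib : (@torus_measure R n).-integrable setT (EFin \o b) by exact: (@bounded_integrable _ _ _ (@torus_measure R n) _ _ mb bM).
have ia : (@circle_measure R).-integrable setT (EFin \o a) by exact: (@bounded_integrable _ _ _ (@circle_measure R) _ _ ma aM).
have -> : \int[@torus_measure R n.+1]_x f x = \int[P]_z g z.
  rewrite /Rintegral; congr fine.
  transitivity (\int[pushforward P (@consT R n)]_x (f x)%:E)%E; first by [].
  rewrite integral_pushforward//; last 3 first.
  - exact: measurable_consT.
  - exact/measurable_EFinP.
  - rewrite preimage_setT; apply: eq_integrable ig => // z _.
    by rewrite /= gf.
  by rewrite preimage_setT; apply: eq_integral => z _; rewrite /= gf.
have bfin : (\int[@torus_measure R n]_y (b y)%:E)%E \is a fin_num by exact: integrable_fin_num ib.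
have inner x : fubini_F (@torus_measure R n) (EFin \o g) x =
    ((a x)%:E * \int[@torus_measure R n]_y (b y)%:E)%E.
  rewrite /fubini_F -integralZl//; apply: eq_integral => y _.
rewrite /Rintegral -fineM//; last exact: integrable_fin_num ia.
congr fine; rewrite -(integral12_prod_meas1 ig) -(fineK bfin) -integralZr//.
by apply: eq_integral => x _; rewrite inner fineK.
Qed.

Lemma torus_measureT n : @torus_measure R n setT = ((2 * pi) ^+ n)%:E.
Proof.
elim: n => [|n IH]; first by rewrite /= diracT.
transitivity (@circle_measure R setT * @torus_measure R n setT)%E; last first.
  by rewrite circle_measureT IH -EFinM exprS.
by rewrite torus_measureSE// preimage_setT -setXTT product_measure1E.
Qed.

Definition phase d (k : 'I_d -> int) (x : point d) : R :=
  \sum_(j < d) (k j)%:~R * (tnth x j : R).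

Lemma measurable_phase d (k : 'I_d -> int) : measurable_fun setT (phase k).
Proof.
apply: measurable_sum => j; apply: measurable_funM => //; exact: measurable_coord.
Qed.

Lemma measurable_cos_phase d (k : 'I_d -> int) : measurable_fun setT (fun x => cos (phase k x)).
Proof.
apply: measurableT_comp; last exact: measurable_phase.
apply: continuous_measurable_fun; exact: continuous_cos.
Qed.

Lemma measurable_sin_phase d (k : 'I_d -> int) : measurable_fun setT (fun x => sin (phase k x)).
Proof.
apply: measurableT_comp; last exact: measurable_phase.
apply: continuous_measurable_fun; exact: continuous_sin.
Qed.

Lemma phase_rec d (k : 'I_d.+1 -> int) (x : point d.+1) :
  phase k x = (k ord0)%:~R * (thead x : R) + phase (fun j => k (lift ord0 j)) [tuple of behead x].
Proof.
rewrite /phase big_ord_recl; congr (_ + _); apply: eq_bigr => j _.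
by rewrite tnth_behead; congr (_ * tnth x _); apply: val_inj; rewrite /= inordK// ltnS.
Qed.

(** Cosine and sine go through the induction together, because the addition formulas mix them when
    one coordinate is split off. *)
Lemma torus_Rintegral_trig d (k : 'I_d -> int) :
  \int[@torus_measure R d]_x cos (phase k x) =
    (if k == (fun=> 0) then (2 * pi) ^+ d else 0) /\
  \int[@torus_measure R d]_x sin (phase k x) = 0.
Proof.
elim: d k => [|d IH] k.
  have k0 : k = (fun=> 0) by apply/funext => -[].
  have p0 x : phase k x = 0 by rewrite /phase big_ord0.
  have -> : (k == (fun=> 0)) = true by apply/eqP.
  split.
    by under eq_Rintegral do rewrite p0 cos0; rewrite Rintegral_cst// [X in fine X]diracT mulr1.
  by under eq_Rintegral do rewrite p0 sin0; rewrite Rintegral_cst// mul0r.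
have [c s] := IH (fun j => k (lift ord0 j)).
have sinM (x : R) : `|sin x| <= 1 by exact: sin_max.
have cosM (x : R) : `|cos x| <= 1 by exact: cos_max.
have mcos : measurable_fun setT (fun x : R => cos ((k ord0)%:~R * x)).
  apply: continuous_measurable_fun; exact: continuous_cosZ.
have msin : measurable_fun setT (fun x : R => sin ((k ord0)%:~R * x)).
  apply: continuous_measurable_fun; exact: continuous_sinZ.
set k' := fun j => k (lift ord0 j) in c s *.
have ib (f : point d.+1 -> R) : measurable_fun setT f -> (forall x, `|f x| <= 1) ->
    (@torus_measure R d.+1).-integrable setT (EFin \o f).
  by move=> mf fM; exact: (@bounded_integrable _ _ _ (@torus_measure R d.+1) _ _ mf fM).
have le1 (a b : R) : `|a| <= 1 -> `|b| <= 1 -> `|a * b| <= 1.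
  by move=> a1 b1; rewrite normrM -[leRHS]mulr1 ler_pM.
have mh (f : R -> R) : measurable_fun setT f ->
    measurable_fun setT (fun x : point d.+1 => f (thead x)).
  by move=> mf; apply: measurableT_comp => //; exact: measurable_tnth.
have mt (f : point d -> R) : measurable_fun setT f ->
    measurable_fun setT (fun x : point d.+1 => f [tuple of behead x]).
  by move=> mf; apply: measurableT_comp => //; exact: measurable_behead.
have kE : (k == (fun=> 0)) = (k ord0 == 0) && (k' == (fun=> 0)).
  apply/eqP/andP => [k0|[/eqP k0 /eqP k'0]]; first by split; apply/eqP; rewrite ?/k' k0.
  by apply/funext => j; case: (unliftP ord0 j) => [i ->|->//]; exact: (congr1 (@^~ i) k'0).
have mcosp := measurable_cos_phase k'.
have msinp := measurable_sin_phase k'.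
split.
- under eq_Rintegral do rewrite phase_rec cosD.
  rewrite RintegralB//; last 2 first.
  + apply: ib => [|x]; last exact: le1.
    by apply: measurable_funM; [exact: (mh _ mcos)|exact: (mt _ mcosp)].
  + apply: ib => [|x]; last exact: le1.
    by apply: measurable_funM; [exact: (mh _ msin)|exact: (mt _ msinp)].
  rewrite (torus_Rintegral_rec mcos (fun=> cosM _) mcosp (fun=> cosM _)).
  rewrite (torus_Rintegral_rec msin (fun=> sinM _) msinp (fun=> sinM _)).
  rewrite c s mulr0 subr0 circle_integral_cos kE.
  by case: eqP => _ /=; [case: ifP => _; rewrite ?mulr0 ?exprS|rewrite mul0r].
- under eq_Rintegral do rewrite phase_rec sinD.
  rewrite RintegralD//; last 2 first.
  + apply: ib => [|x]; last exact: le1.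
    by apply: measurable_funM; [exact: (mh _ msin)|exact: (mt _ mcosp)].
  + apply: ib => [|x]; last exact: le1.
    by apply: measurable_funM; [exact: (mh _ mcos)|exact: (mt _ msinp)].
  rewrite (torus_Rintegral_rec msin (fun=> sinM _) mcosp (fun=> cosM _)).
  rewrite (torus_Rintegral_rec mcos (fun=> cosM _) msinp (fun=> sinM _)).
  by rewrite s circle_integral_sin mul0r mulr0 addr0.
Qed.

(** Sine and cosine take the same values at [0] and [2 pi], so coordinates equal to either must be
    discarded before a coordinate can be recovered from them. The exceptional set has its head in
    [{0, 2 pi}] or outside the support, or its tail in the previous null set. *)
Lemma torus_interior n :
  {ae @torus_measure R n, forall x, forall j, 0 < (tnth x j : R) < 2 * pi}.
Proof.
elim: n => [|n IH].
  by apply: aeW => x [].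
pose B : set (measurableTypeR R) := ~` [set` `]0, 2 * pi[ ].
have mB : measurable B by apply: measurableC; exact: measurable_itv.
have B0 : @circle_measure R B = 0.
  rewrite -[LHS]/(lebesgue_measure (B `&` @circle R)).
  have -> : B `&` @circle R = [set 0; 2 * pi] :> set R.
    apply/seteqP; split => x; rewrite /B /circle /= !in_itv/=.
      move=> [/negP]; rewrite negb_and -!leNgt => /orP[] h /andP[h1 h2]; [left|right];
        by apply/eqP; rewrite eq_le ?h ?h1 ?h2.
    by move=> [->|->]; rewrite ltxx ?andbF lexx ?(ltW (pi2_gt0 R)).
  by rewrite countable_lebesgue_measure0//; exact/finite_set_countable/finite_set2.
have [N [mN N0 hN]] := IH.
exists ((fun x : point n.+1 => thead x) @^-1` B `|` (fun x : point n.+1 => [tuple of behead x] : point n) @^-1` N).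
have m1 : measurable ((fun x : point n.+1 => thead x) @^-1` B).
  by rewrite -[X in measurable X]setTI; apply: measurable_tnth.
have m2 : measurable ((fun x : point n.+1 => [tuple of behead x] : point n) @^-1` N).
  by rewrite -[X in measurable X]setTI; apply: measurable_behead.
split.
- exact: measurableU.
- have z1 : @torus_measure R n.+1 ((fun x : point n.+1 => thead x) @^-1` B) = 0.
    rewrite torus_measureSE//.
    have -> : @consT R n @^-1` ((fun x : point n.+1 => thead x) @^-1` B) = B `*` setT.
      by apply/seteqP; split => -[a b]; rewrite /= theadE => // -[].
    rewrite product_measure1E//.
    transitivity (@circle_measure R B * @torus_measure R n setT)%E; first by [].
    by rewrite B0 mul0e.
  have z2 : @torus_measure R n.+1
      ((fun x : point n.+1 => [tuple of behead x] : point n) @^-1` N) = 0.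
    rewrite torus_measureSE//.
    have -> : @consT R n @^-1` ((fun x : point n.+1 => [tuple of behead x] : point n) @^-1` N) =
        setT `*` N.
      have E (a : measurableTypeR R) (b : point n) :
          [tuple of behead (consT (a, b))] = b by exact: val_inj.
      apply/seteqP; split => -[a b] /=; first by rewrite E.
      by move=> [_]; rewrite E.
    rewrite product_measure1E//.
    transitivity (@circle_measure R setT * @torus_measure R n N)%E; first by [].
    by rewrite N0 mule0.
  apply/eqP; rewrite -measure_le0 (le_trans (measureU2 _ m1 m2))//; rewrite -[leRHS]adde0 leeD// measure_le0; apply/eqP; [exact: z1|exact: z2].
- move=> x /= nx; apply: contrapT => /not_orP[xB xN]; apply: nx => j.
  case: (unliftP ord0 j) => [i ->|->]; last first.
    by move/contrapT : xB; rewrite /= in_itv.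
  have : forall j, 0 < (tnth [tuple of behead x] j : R) < 2 * pi.
    by apply: contrapT => h; apply: xN; exact: hN.
  by move=> /(_ i); rewrite tnth_behead (_ : inord i.+1 = lift ord0 i)//; apply: val_inj; rewrite /= inordK// ltnS.
Qed.
End torus_integral.

(** * Fourier coefficients *)

Section L2_facts.
Local Open Scope complex_scope.
Local Open Scope quotient_scope.
Context d (T : measurableType d) (R : realType).
Variable mu : {finite_measure set T -> \bar R}.
Implicit Types (u v : T -> R) (f g : L2 mu).

Lemma Lfun_measurable u : u \in Lfun mu 2%:E -> measurable_fun setT u.
Proof. by rewrite inE => /andP[]; rewrite inE. Qed.

Lemma Lfun2_bounded u (M : R) : measurable_fun setT u -> (forall x, `|u x| <= M) ->
  u \in Lfun mu 2%:E.
Proof.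
move=> mu_ uM; rewrite inE/=; apply/andP; split; rewrite inE//=.
rewrite /finite_norm unlock poweR_lty//.
have M0 (x : T) : 0 <= M by rewrite (le_trans _ (uM x)).
rewrite (eq_integral (fun x => (`|u x| ^+ 2)%:E)); last first.
  by move=> x _ /=; rewrite powR_mulrn.
apply: integrable_lty => //; apply: (@bounded_integrable _ _ _ _ _ (M ^+ 2)) => //.
  apply: measurable_funX; exact: measurableT_comp.
by move=> x; rewrite ger0_norm ?sqr_ge0// lerXn2r// nnegrE M0.
Qed.

Lemma Lfun2M_integrable u v : u \in Lfun mu 2%:E -> v \in Lfun mu 2%:E ->
  mu.-integrable setT (EFin \o (fun x => u x * v x)).
Proof. by move=> u2 v2; apply/Lfun1_integrable; exact: Lfun2_mul_Lfun1. Qed.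

Lemma Lfun2_lincomb u v (a b : R) : u \in Lfun mu 2%:E -> v \in Lfun mu 2%:E ->
  (fun x => a * u x + b * v x) \in Lfun mu 2%:E.
Proof.
have p1 : (1 <= 2%:E :> \bar R)%E by rewrite lee_fin ler1n.
have cl := Lfun_submod_closed mu p1.
move=> u2 v2; have w2 : b *: v \in Lfun mu 2%:E.
  by rewrite -[b *: v]addr0; apply: cl.2 => //; exact: cl.1.
exact: (cl.2 a u (b *: v)).
Qed.

Lemma Rintegral_ae u v : measurable_fun setT u -> measurable_fun setT v ->
  {ae mu, forall x, u x = v x} -> \int[mu]_x u x = \int[mu]_x v x.
Proof.
move=> mu_ mv uv; rewrite /Rintegral; congr fine; apply: ae_eq_integral => //.
- exact/measurable_EFinP.
- exact/measurable_EFinP.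
- by move: uv; apply: filterS => x -> _.
Qed.

Lemma Rintegral_lincomb u v (a b : R) :
  mu.-integrable setT (EFin \o u) -> mu.-integrable setT (EFin \o v) ->
  \int[mu]_x (a * u x + b * v x) = a * \int[mu]_x u x + b * \int[mu]_x v x.
Proof.
move=> iu iv; rewrite RintegralD//.
- by rewrite !RintegralZl.
- by have := integrableZl measurableT a iu; apply: eq_integrable.
- by have := integrableZl measurableT b iv; apply: eq_integrable.
Qed.

Definition complex_fun u v : T -> R[i]^o := fun x => u x +i* v x.

Lemma complex_fun_L2 u v : u \in Lfun mu 2%:E -> v \in Lfun mu 2%:E ->
  complex_fun u v \in L2pred mu.
Proof. by move=> u2 v2; apply/andP; split; [exact: u2|exact: v2]. Qed.

Definition L2_of u v (u2 : u \in Lfun mu 2%:E) (v2 : v \in Lfun mu 2%:E) : L2 mu :=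
  \pi_(L2 mu) (MkL2fun (complex_fun_L2 u2 v2)).

(** The representative chosen by the quotient agrees with [h] only almost everywhere; every later
    computation with [L2_to_fun] starts from such an identity. *)
Lemma L2_to_fun_pi (h : L2fun mu) :
  {ae mu, forall x, L2_to_fun (\pi_(L2 mu) h) x = h x}.
Proof.
have : repr (\pi_(L2 mu) h) - h \in ae0 (mu := mu).
  by rewrite Quotient.idealrBE reprK.
move=> /asboolP; apply: filterS => x; rewrite /L2_to_fun => e.
by apply/eqP; rewrite -subr_eq0; apply/eqP.
Qed.

Lemma L2_Re_Lfun f : (fun x => complex.Re (L2_to_fun f x)) \in Lfun mu 2%:E.
Proof. by rewrite /L2_to_fun; case: (repr f) => h /= /andP[]. Qed.

Lemma L2_Im_Lfun f : (fun x => complex.Im (L2_to_fun f x)) \in Lfun mu 2%:E.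
Proof. by rewrite /L2_to_fun; case: (repr f) => h /= /andP[]. Qed.

Lemma L2_to_fun_lin (a : R[i]) f g :
  {ae mu, forall x, L2_to_fun (a *: f + g) x = a * L2_to_fun f x + L2_to_fun g x}.
Proof.
have -> : a *: f + g = \pi_(L2 mu) (a *: (repr f : L2fun mu) + repr g).
  by rewrite pi_L2D -pi_L2_scale !reprK.
exact: L2_to_fun_pi.
Qed.

Lemma L2norm_sqr f u v : u \in Lfun mu 2%:E -> v \in Lfun mu 2%:E ->
  {ae mu, forall x, L2_to_fun f x = u x +i* v x} ->
  L2norm f ^+ 2 = \int[mu]_x (u x ^+ 2 + v x ^+ 2).
Proof.
move=> u2 v2 fuv.
have m (w w' : T -> R) : w \in Lfun mu 2%:E -> w' \in Lfun mu 2%:E ->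
    measurable_fun setT (fun x => w x ^+ 2 + w' x ^+ 2).
  move=> w2 w'2; apply: measurable_funD; apply: measurable_funX; exact: Lfun_measurable.
have sqr z : normc z ^+ 2 = complex.Re z ^+ 2 + complex.Im z ^+ 2 :> R.
  by case: z => a b /=; rewrite sqr_sqrtr// addr_ge0 ?sqr_ge0.
rewrite sqr_sqrtr; last by apply: Rintegral_ge0 => x _; rewrite sqr_ge0.
under eq_Rintegral do rewrite sqr.
apply: Rintegral_ae; [|exact: m|].
  by apply: m; [exact: L2_Re_Lfun|exact: L2_Im_Lfun].
by move: fuv; apply: filterS => x ->.
Qed.

End L2_facts.

Section fourier.
Local Open Scope complex_scope.
Context (R : realType) (d : nat).
Notation point := (d.-tuple (measurableTypeR R)).
Notation mu := (@torus_measure R d).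
Implicit Types (u v : point -> R) (f g : L2T R d) (k l : 'I_d -> int).

Definition fourier_scale : R := (2 * pi) `^ (- (d%:R / 2)).

Lemma fourier_scale_sqr : fourier_scale ^+ 2 * (2 * pi) ^+ d = 1.
Proof.
rewrite /fourier_scale -powR_mulrn ?powR_ge0// -powRrM.
rewrite (_ : - (d%:R / 2) * 2 = - d%:R); last by field.
rewrite powRN powR_mulrn ?mulr_ge0 ?pi_ge0// mulVf// expf_neq0// gt_eqF//.
exact: pi2_gt0.
Qed.

Definition cos_coef u k : R := \int[mu]_x (u x * cos (phase k x)).
Definition sin_coef u k : R := \int[mu]_x (u x * sin (phase k x)).

Lemma cos_phase_Lfun k : (fun x => cos (phase k x)) \in Lfun mu 2%:E.
Proof.
apply: (@Lfun2_bounded _ _ _ _ _ 1); first exact: measurable_cos_phase.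
by move=> x; exact: cos_max.
Qed.

Lemma sin_phase_Lfun k : (fun x => sin (phase k x)) \in Lfun mu 2%:E.
Proof.
apply: (@Lfun2_bounded _ _ _ _ _ 1); first exact: measurable_sin_phase.
by move=> x; exact: sin_max.
Qed.

Lemma cos_coef_lin u v (a b : R) k : u \in Lfun mu 2%:E -> v \in Lfun mu 2%:E ->
  cos_coef (fun x => a * u x + b * v x) k = a * cos_coef u k + b * cos_coef v k.
Proof.
move=> u2 v2; have c2 := cos_phase_Lfun k.
rewrite /cos_coef -Rintegral_lincomb; [|exact: Lfun2M_integrable|exact: Lfun2M_integrable].
by apply: eq_Rintegral => x _; ring.
Qed.

Lemma sin_coef_lin u v (a b : R) k : u \in Lfun mu 2%:E -> v \in Lfun mu 2%:E ->
  sin_coef (fun x => a * u x + b * v x) k = a * sin_coef u k + b * sin_coef v k.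
Proof.
move=> u2 v2; have c2 := sin_phase_Lfun k.
rewrite /sin_coef -Rintegral_lincomb; [|exact: Lfun2M_integrable|exact: Lfun2M_integrable].
by apply: eq_Rintegral => x _; ring.
Qed.

(** Expand [(u + i v) (cos - i sin)]. Allowing any real [u], [v] that represent [f] almost
    everywhere removes the quotient representative from further calculations. *)
Lemma fourier_coef_ReIm f u v k : u \in Lfun mu 2%:E -> v \in Lfun mu 2%:E ->
  {ae mu, forall x, L2_to_fun f x = u x +i* v x} ->
  fourier_coef f k = (fourier_scale * (cos_coef u k + sin_coef v k)) +i*
                     (fourier_scale * (cos_coef v k - sin_coef u k)).
Proof.
move=> u2 v2 fuv.
have c2 := cos_phase_Lfun k; have s2 := sin_phase_Lfun k.
rewrite /fourier_coef -/fourier_scale /torus_integral.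
pose z x := L2_to_fun f x; pose p x := complex.Re (z x); pose q x := complex.Im (z x).
have p2 : p \in Lfun mu 2%:E by exact: L2_Re_Lfun.
have q2 : q \in Lfun mu 2%:E by exact: L2_Im_Lfun.
have mM (w w' : point -> R) : w \in Lfun mu 2%:E -> w' \in Lfun mu 2%:E ->
    measurable_fun setT (fun x => w x * w' x).
  by move=> w2 w'2; apply: measurable_funM; [exact: (Lfun_measurable w2)|exact: (Lfun_measurable w'2)].
have -> : \int[mu]_x complex.Re (z x * expi (- phase k x)) = cos_coef u k + sin_coef v k.
  have -> : cos_coef u k + sin_coef v k = \int[mu]_x (1 * (u x * cos (phase k x)) + 1 * (v x * sin (phase k x))).
    by rewrite (Rintegral_lincomb 1 1 (Lfun2M_integrable u2 c2) (Lfun2M_integrable v2 s2)) !mul1r.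
  rewrite (@eq_Rintegral _ _ _ mu setT (fun x => 1 * (p x * cos (phase k x)) + 1 * (q x * sin (phase k x)))); last first.
    by move=> x _; rewrite /expi cosN sinN /p /q; case: (z x) => a b /=; ring.
  apply: Rintegral_ae.
  - by apply: measurable_funD; apply: measurable_funM => //; exact: mM.
  - by apply: measurable_funD; apply: measurable_funM => //; exact: mM.
  - by move: fuv; apply: filterS => x; rewrite /p /q /z => ->.
have -> : \int[mu]_x complex.Im (z x * expi (- phase k x)) = cos_coef v k - sin_coef u k.
  have -> : cos_coef v k - sin_coef u k = \int[mu]_x (1 * (v x * cos (phase k x)) + (-1) * (u x * sin (phase k x))).
    by rewrite (Rintegral_lincomb 1 (-1) (Lfun2M_integrable v2 c2) (Lfun2M_integrable u2 s2)) mul1r mulN1r.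
  rewrite (@eq_Rintegral _ _ _ mu setT (fun x => 1 * (q x * cos (phase k x)) + (-1) * (p x * sin (phase k x)))); last first.
    by move=> x _; rewrite /expi cosN sinN /p /q; case: (z x) => a b /=; ring.
  apply: Rintegral_ae.
  - by apply: measurable_funD; apply: measurable_funM => //; exact: mM.
  - by apply: measurable_funD; apply: measurable_funM => //; exact: mM.
  - by move: fuv; apply: filterS => x; rewrite /p /q /z => ->.
by apply/eqP; rewrite eq_complex /= !mul0r subr0 addr0 !eqxx.
Qed.
End fourier.

Lemma integrable_lincomb d (T : measurableType d) (R : realType)
    (mu : {finite_measure set T -> \bar R}) (u v : T -> R) (a b : R) :
  mu.-integrable setT (EFin \o u) -> mu.-integrable setT (EFin \o v) ->
  mu.-integrable setT (EFin \o (fun x => a * u x + b * v x)).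
Proof.
move=> iu iv; have ia := integrableZl measurableT a iu.
have ib := integrableZl measurableT b iv.
by have := integrableD measurableT ia ib; apply: eq_integrable.
Qed.

(** * Orthonormality and the Pythagorean step *)

Section fourier_basis.
Local Open Scope complex_scope.
Local Open Scope quotient_scope.
Context (R : realType) (d : nat).
Notation point := (d.-tuple (measurableTypeR R)).
Notation mu := (@torus_measure R d).
Implicit Types (u v : point -> R) (f g : L2T R d) (k l : 'I_d -> int).

Lemma L2_ReIm f : exists u v, [/\ u \in Lfun mu 2%:E, v \in Lfun mu 2%:E &
  {ae mu, forall x, L2_to_fun f x = u x +i* v x}].
Proof.
exists (fun x => complex.Re (L2_to_fun f x)), (fun x => complex.Im (L2_to_fun f x)).
split; [exact: L2_Re_Lfun|exact: L2_Im_Lfun|].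
by apply: aeW => x; case: (L2_to_fun f x).
Qed.

Lemma fourier_coef_linear (a : R[i]) f g k :
  fourier_coef (a *: f + g) k = a * fourier_coef f k + fourier_coef g k.
Proof.
have [u [v [u2 v2 fuv]]] := L2_ReIm f.
have [u' [v' [u'2 v'2 guv]]] := L2_ReIm g.
case: a => a1 a2; set a := _ +i* _.
(* The explicit factors 1 give the shape of a two-term combination required by [Lfun2_lincomb] and
   [cos_coef_lin]. *)
pose p x := 1 * (a1 * u x + (- a2) * v x) + 1 * u' x.
pose q x := 1 * (a1 * v x + a2 * u x) + 1 * v' x.
have p2 : p \in Lfun mu 2%:E by do 2?apply: Lfun2_lincomb.
have q2 : q \in Lfun mu 2%:E by do 2?apply: Lfun2_lincomb.
have e : {ae mu, forall x, L2_to_fun (a *: f + g) x = p x +i* q x}.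
  have := L2_to_fun_lin a f g; move: fuv guv; apply: filterS3 => x -> -> ->.
  by apply/eqP; rewrite eq_complex /p /q /=; apply/andP; split; apply/eqP; ring.
rewrite (fourier_coef_ReIm k p2 q2 e) (fourier_coef_ReIm k u2 v2 fuv).
rewrite (fourier_coef_ReIm k u'2 v'2 guv) /p /q.
rewrite !(cos_coef_lin, sin_coef_lin) ?Lfun2_lincomb//.
by apply/eqP; rewrite eq_complex /=; apply/andP; split; apply/eqP; ring.
Qed.

Lemma scaled_cos_Lfun k : (fun x => fourier_scale R d * cos (phase k x)) \in Lfun mu 2%:E.
Proof.
have c2 := cos_phase_Lfun R k.
have := Lfun2_lincomb (fourier_scale R d) 0 c2 c2.
by under eq_fun do rewrite mul0r addr0.
Qed.

Lemma scaled_sin_Lfun k : (fun x => fourier_scale R d * sin (phase k x)) \in Lfun mu 2%:E.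
Proof.
have c2 := sin_phase_Lfun R k.
have := Lfun2_lincomb (fourier_scale R d) 0 c2 c2.
by under eq_fun do rewrite mul0r addr0.
Qed.

Definition fourier_basis k : L2T R d := L2_of (scaled_cos_Lfun k) (scaled_sin_Lfun k).

Lemma fourier_basisE k : {ae mu, forall x, L2_to_fun (fourier_basis k) x =
  (fourier_scale R d * cos (phase k x)) +i* (fourier_scale R d * sin (phase k x))}.
Proof. exact: L2_to_fun_pi. Qed.

Lemma phaseB k l (x : point) : phase (fun j => k j - l j) x = phase k x - phase l x.
Proof.
by rewrite /phase -sumrB; apply: eq_bigr => j _; rewrite intrB mulrBl.
Qed.

(** The subtraction formulas reduce the integrand to cosine and sine of the phase of [k - l]; the
    two scaling factors cancel the total mass [(2 pi)^d]. *)
Lemma fourier_coef_basis k l : fourier_coef (fourier_basis k) l = (k == l)%:R.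
Proof.
have kc := scaled_cos_Lfun k; have ks := scaled_sin_Lfun k.
have lc := cos_phase_Lfun R l; have ls := sin_phase_Lfun R l.
rewrite (fourier_coef_ReIm l kc ks (fourier_basisE k)).
have [c s] := torus_Rintegral_trig R (fun j => k j - l j).
have -> : cos_coef (fun x => fourier_scale R d * cos (phase k x)) l +
    sin_coef (fun x => fourier_scale R d * sin (phase k x)) l =
    fourier_scale R d * (if k == l then (2 * pi) ^+ d else 0).
  have -> : (k == l) = ((fun j => k j - l j) == (fun=> 0)).
    apply/eqP/eqP => [->|kl]; first by apply/funext => j; rewrite subrr.
    by apply/funext => j; apply/eqP; rewrite -subr_eq0; apply/eqP; exact: (congr1 (@^~ j) kl).
  rewrite -c -[LHS]mul1r mulrDr -(Rintegral_lincomb 1 1 (Lfun2M_integrable kc lc) (Lfun2M_integrable ks ls)).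
  rewrite -RintegralZl//; last first.
    apply: (@bounded_integrable _ _ _ _ _ 1); first exact: measurable_cos_phase.
    by move=> x; exact: cos_max.
  by apply: eq_Rintegral => x _; rewrite phaseB cosB; ring.
have -> : cos_coef (fun x => fourier_scale R d * sin (phase k x)) l -
    sin_coef (fun x => fourier_scale R d * cos (phase k x)) l = 0.
  rewrite -[RHS](mulr0 (fourier_scale R d)) -s -[X in X - _]mul1r -mulN1r.
  rewrite -(Rintegral_lincomb 1 (-1) (Lfun2M_integrable ks lc) (Lfun2M_integrable kc ls)).
  rewrite -RintegralZl//; last first.
    apply: (@bounded_integrable _ _ _ _ _ 1); first exact: measurable_sin_phase.
    by move=> x; exact: sin_max.
  by apply: eq_Rintegral => x _; rewrite phaseB sinB; ring.
rewrite -(rmorph_nat (real_complex R)) /=.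
apply/eqP; rewrite eq_complex /= mulr0 eqxx andbT; apply/eqP.
rewrite mulrA -expr2; case: eqP => _ /=; last by rewrite mulr0.
by rewrite fourier_scale_sqr.
Qed.

Lemma L2norm_sqr_sub f k :
  L2norm (f - fourier_coef f k *: fourier_basis k) ^+ 2 =
  L2norm f ^+ 2 - normc (fourier_coef f k) ^+ 2.
Proof.
have [u [v [u2 v2 fuv]]] := L2_ReIm f.
have kc := cos_phase_Lfun R k; have ks := sin_phase_Lfun R k.
have E := fourier_coef_ReIm k u2 v2 fuv.
set c := fourier_coef f k in E *; set K := fourier_scale R d in E.
set C := cos_coef u k + sin_coef v k in E; set S := cos_coef v k - sin_coef u k in E.
pose p x := 1 * u x + (-1) * (K * (K * C) * cos (phase k x) + - (K * (K * S)) * sin (phase k x)).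
pose q x := 1 * v x + (-1) * (K * (K * C) * sin (phase k x) + (K * (K * S)) * cos (phase k x)).
have p2 : p \in Lfun mu 2%:E by do 2?apply: Lfun2_lincomb.
have q2 : q \in Lfun mu 2%:E by do 2?apply: Lfun2_lincomb.
have e : {ae mu, forall x, L2_to_fun (f - c *: fourier_basis k) x = p x +i* q x}.
  have := L2_to_fun_lin (- c) (fourier_basis k) f; rewrite scaleNr addrC.
  move: fuv (fourier_basisE k); apply: filterS3 => x -> -> ->.
  by rewrite E; apply/eqP; rewrite eq_complex /p /q /=; apply/andP; split; apply/eqP; rewrite -/K; ring.
rewrite (L2norm_sqr p2 q2 e) (L2norm_sqr u2 v2 fuv) E /= sqr_sqrtr ?addr_ge0 ?sqr_ge0//.
have i1 := Lfun2M_integrable u2 u2; have i2 := Lfun2M_integrable v2 v2.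
have i3 := Lfun2M_integrable u2 kc; have i4 := Lfun2M_integrable v2 ks.
have i5 := Lfun2M_integrable v2 kc; have i6 := Lfun2M_integrable u2 ks.
have i12 := integrable_lincomb 1 1 i1 i2; have i34 := integrable_lincomb 1 1 i3 i4.
have i56 := integrable_lincomb 1 (-1) i5 i6.
have i36 := integrable_lincomb (- 2 * K ^+ 2 * C) (- 2 * K ^+ 2 * S) i34 i56.
(* The squared modulus of [c] times the basis function, constant because an exponential has modulus
   one. Since [c = K (C + i S)] and [K^2 (2 pi)^d = 1], its integral is the squared modulus of [c],
   while the cross terms contribute minus twice that. *)
pose D := K ^+ 4 * (C ^+ 2 + S ^+ 2).
have iD : mu.-integrable setT (EFin \o (fun=> D)).
  exact: finite_measure_integrable_cst.
rewrite (@eq_Rintegral _ _ _ _ _ (fun x => 1 * (1 * (u x * u x) + 1 * (v x * v x)) +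
  1 * (1 * ((- 2 * K ^+ 2 * C) * (1 * (u x * cos (phase k x)) + 1 * (v x * sin (phase k x))) +
   (- 2 * K ^+ 2 * S) * (1 * (v x * cos (phase k x)) + (-1) * (u x * sin (phase k x)))) + 1 * D))); last first.
  move=> x _; have -> : 1 * D = D * (cos (phase k x) ^+ 2 + sin (phase k x) ^+ 2).
    by rewrite cos2Dsin2 mulr1 mul1r.
  by rewrite /p /q /D; ring.
rewrite (Rintegral_lincomb 1 1 i12 (integrable_lincomb 1 1 i36 iD)) (Rintegral_lincomb 1 1 i36 iD).
rewrite (Rintegral_lincomb _ _ i34 i56) (Rintegral_lincomb 1 1 i3 i4) (Rintegral_lincomb 1 (-1) i5 i6).
rewrite Rintegral_cst// [X in fine X]torus_measureT /=.
rewrite -/(cos_coef u k) -/(cos_coef v k) -/(sin_coef u k) -/(sin_coef v k).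
have -> : cos_coef u k = C - sin_coef v k by rewrite /C addrK.
have -> : cos_coef v k = S + sin_coef u k by rewrite /S subrK.
have -> : D * (2 * pi) ^+ d = K ^+ 2 * (C ^+ 2 + S ^+ 2).
  transitivity (K ^+ 2 * (2 * pi) ^+ d * (K ^+ 2 * (C ^+ 2 + S ^+ 2))).
    by rewrite /D; ring.
  by rewrite /K fourier_scale_sqr mul1r.
rewrite (@eq_Rintegral _ _ _ _ _ (fun x => u x ^+ 2 + v x ^+ 2)); last first.
  by move=> x _; rewrite !expr2 !mul1r.
by ring.
Qed.

End fourier_basis.

(** * Density of trigonometric polynomials *)

Lemma bernoulli_ineq (R : realFieldType) (a : R) m : -1 <= a -> 1 + m%:R * a <= (1 + a) ^+ m.
Proof.
move=> a1; elim: m => [|m IH]; first by rewrite mul0r addr0.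
rewrite exprS -natr1; apply: (@le_trans _ _ ((1 + a) * (1 + m%:R * a))).
  by have := ler0n R m; nra.
by rewrite ler_wpM2l//; lra.
Qed.

Section threshold.
Context (R : realType).

Definition threshold_exp (v : R) n := (Num.truncn (v^-1 ^+ n)).+1.

Lemma threshold_exp_bounds (v : R) n : 0 < v ->
  v^-1 ^+ n <= (threshold_exp v n)%:R <= v^-1 ^+ n + 1.
Proof.
move=> v0; have p0 : 0 <= v^-1 ^+ n by rewrite exprn_ge0// invr_ge0 ltW.
have /andP[t1 t2] := truncn_itv p0.
by rewrite /threshold_exp (ltW t2)/= -natr1 lerD2r.
Qed.

(** The first factor separates [y < v] from [y > v], because [threshold_exp v n * y ^+ n] behaves
    like [(y / v) ^+ n]; the second one removes the point [y = v]. *)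
Definition threshold_fun (v y : R) n : R :=
  (1 - y ^+ n) ^+ threshold_exp v n * (1 - (1 - (y - v) ^+ 2) ^+ n).

(** Let [m = threshold_exp v n]. If [y < v], Bernoulli bounds the first factor below by [1 - m y^n],
    and [m y^n <= (y / v)^n + y^n] tends to 0. If [y > v], then [(1 - y^n)^m (1 + y^n)^m <= 1] and
    Bernoulli for the second power bound the first factor by [(v / y)^n]. *)
Lemma threshold_fun_cvg (v y : R) : 0 < v <= 1 -> 0 <= y <= 1 ->
  threshold_fun v y n @[n --> \oo] --> ((y < v)%R%:R : R).
Proof.
move=> /andP[v0 v1] /andP[y0 y1].
have [->|yv] := eqVneq y v.
  rewrite ltxx (_ : threshold_fun v v = fun=> 0); first exact: cvg_cst.
  by apply/funext => n; rewrite /threshold_fun subrr expr0n/= subr0 expr1n subrr mulr0.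
have h2 : 1 - (1 - (y - v) ^+ 2) ^+ n @[n --> \oo] --> (1 - 0 : R).
  apply: cvgB; first exact: cvg_cst.
  apply: cvg_expr; rewrite ger0_norm; last by nra.
  by rewrite ltrBlDr ltrDl lt_neqAle sqr_ge0 andbT eq_sym sqrf_eq0 subr_eq0.
have yn01 n : 0 <= 1 - y ^+ n <= 1.
  by rewrite subr_ge0 exprn_ile1//= gerBl exprn_ge0.
suff h1 : (1 - y ^+ n) ^+ threshold_exp v n @[n --> \oo] --> ((y < v)%R%:R : R).
  by have := cvgM h1 h2; rewrite subr0 mulr1; exact.
have [yltv|vley] := ltP y v.
  have hz : (y / v) ^+ n + y ^+ n @[n --> \oo] --> (0 + 0 : R).
    apply: cvgD; apply: cvg_expr; rewrite ger0_norm ?divr_ge0 ?(ltW v0)//.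
      by rewrite ltr_pdivrMr// mul1r.
    exact: lt_le_trans v1.
  have hl : 1 - ((y / v) ^+ n + y ^+ n) @[n --> \oo] --> (1 - (0 + 0) : R).
    by apply: cvgB => //; exact: cvg_cst.
  rewrite addr0 subr0 in hl; apply: squeeze_cvgr hl (cvg_cst (1 : R)).
  apply: nearW => n; have /andP[a0 a1] := yn01 n.
  rewrite exprn_ile1// andbT.
  have /andP[_ m2] := threshold_exp_bounds n v0.
  apply: le_trans (bernoulli_ineq (threshold_exp v n) (_ : -1 <= - y ^+ n)); last by lra.
  rewrite mulrN lerD2l lerN2 exprMn; have yn0 : 0 <= y ^+ n by rewrite exprn_ge0.
  by rewrite mulrC; nra.
have vlty : v < y by rewrite lt_neqAle eq_sym yv.
have y_gt0 : 0 < y by lra.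
have hz : (v / y) ^+ n @[n --> \oo] --> (0 : R).
  apply: cvg_expr; rewrite ger0_norm ?divr_ge0 ?(ltW v0)//.
  by rewrite ltr_pdivrMr// mul1r.
apply: squeeze_cvgr (cvg_cst (0 : R)) hz.
apply: nearW => n; have /andP[a0 a1] := yn01 n.
rewrite exprn_ge0//=.
have /andP[m1 _] := threshold_exp_bounds n v0.
have yn0 : 0 < y ^+ n by rewrite exprn_gt0.
have vn0 : 0 < v ^+ n by rewrite exprn_gt0.
set m := threshold_exp v n in m1 *.
have b := bernoulli_ineq m (_ : -1 <= y ^+ n).
have {}b : 1 + m%:R * y ^+ n <= (1 + y ^+ n) ^+ m by apply: b; lra.
have c : (1 - y ^+ n) ^+ m * (1 + y ^+ n) ^+ m <= 1.
  rewrite -exprMn exprn_ile1//; last by nra.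
  by rewrite mulr_ge0//; lra.
rewrite expr_div_n ler_pdivlMr//.
have e : y ^+ n <= v ^+ n * (1 + y ^+ n) ^+ m.
  rewrite -ler_pdivrMl// -exprVn mulrC; apply: le_trans b.
  rewrite mulrC; nra.
have p0 : 0 <= (1 - y ^+ n) ^+ m by rewrite exprn_ge0.
nra.
Qed.

Lemma threshold_fun01 (v y : R) n : 0 < v <= 1 -> 0 <= y <= 1 ->
  0 <= threshold_fun v y n <= 1.
Proof.
move=> v01 y01; rewrite /threshold_fun.
have a : 0 <= 1 - y ^+ n <= 1.
  by case/andP: y01 => ? ?; rewrite subr_ge0 exprn_ile1//= gerBl exprn_ge0.
have b : 0 <= (1 - (y - v) ^+ 2) <= 1.
  case/andP: v01 => ? ?; case/andP: y01 => ? ?; apply/andP; split; last first.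
    by rewrite gerBl sqr_ge0.
  have -> : 1 - (y - v) ^+ 2 = (1 - (y - v)) * (1 + (y - v)) by ring.
  by rewrite mulr_ge0//; lra.
have c : 0 <= 1 - (1 - (y - v) ^+ 2) ^+ n <= 1.
  by case/andP: b => ? ?; rewrite subr_ge0 exprn_ile1//= gerBl exprn_ge0.
case/andP: a => a0 a1; case/andP: c => c0 c1.
by rewrite mulr_ge0 ?exprn_ge0//= -[leRHS]mulr1 ler_pM ?exprn_ge0// exprn_ile1.
Qed.

End threshold.

(** * From an algebra of functions to a sigma-algebra of sets *)

Section algebra_density.
Context d (T : measurableType d) (R : realType).
Variable mu : {finite_measure set T -> \bar R}.
Variable A : set (T -> R).
Hypothesis A_measurable : forall p, A p -> measurable_fun setT p.
Hypothesis A_cst : forall c : R, A (fun=> c).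
Hypothesis A_lin : forall (a b : R) p q, A p -> A q -> A (fun x => a * p x + b * q x).
Hypothesis A_mul : forall p q, A p -> A q -> A (fun x => p x * q x).
Implicit Types (f g p q : T -> R) (E : set T).

Definition unit_valued f := measurable_fun setT f /\ forall x, 0 <= f x <= 1.

Lemma unit_valued_integrable f : unit_valued f -> mu.-integrable setT (EFin \o f).
Proof.
move=> [mf f01]; apply: (@bounded_integrable _ _ _ _ _ 1) => // x.
by have /andP[? ?] := f01 x; rewrite ger0_norm.
Qed.

Lemma unit_valued_dist f g : unit_valued f -> unit_valued g ->
  unit_valued (fun x => `|f x - g x|).
Proof.
move=> [mf f01] [mg g01]; split.
  by apply: measurableT_comp => //; exact: measurable_funB.
move=> x; rewrite normr_ge0 ler_norml /=.
by have := f01 x; have := g01 x; lra.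
Qed.

Lemma unit_valued_compl f : unit_valued f -> unit_valued (fun x => 1 - f x).
Proof.
move=> [mf f01]; split; first exact: measurable_funB.
by move=> x; have := f01 x; lra.
Qed.

Lemma unit_valued_mul f g : unit_valued f -> unit_valued g ->
  unit_valued (fun x => f x * g x).
Proof.
move=> [mf f01] [mg g01]; split; first exact: measurable_funM.
move=> x; have /andP[? ?] := f01 x; have /andP[? ?] := g01 x.
by rewrite mulr_ge0//= -[leRHS]mulr1 ler_pM.
Qed.

Definition dist1 f g : R := \int[mu]_x `|f x - g x|.

Lemma dist1_le f g h k f' g' : unit_valued f -> unit_valued g -> unit_valued h ->
  unit_valued k -> unit_valued f' -> unit_valued g' ->
  (forall x, `|f' x - g' x| <= `|f x - g x| + `|h x - k x|) ->
  dist1 f' g' <= dist1 f g + dist1 h k.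
Proof.
move=> uf ug uh uk uf' ug' H.
have i1 := unit_valued_integrable (unit_valued_dist uf ug).
have i2 := unit_valued_integrable (unit_valued_dist uh uk).
have i3 := unit_valued_integrable (unit_valued_dist uf' ug').
rewrite /dist1 -RintegralD//; apply: le_Rintegral => //.
exact: integrableD i1 i2.
Qed.

Definition approx01 f := unit_valued f /\ forall e : R, 0 < e ->
  exists p, [/\ A p, unit_valued p & dist1 f p < e].

Lemma approx01_algebra p : A p -> (forall x, 0 <= p x <= 1) -> approx01 p.
Proof.
move=> Ap p01; have up : unit_valued p by split => //; exact: A_measurable.
split=> // e e0; exists p; split => //.
by rewrite /dist1; under eq_Rintegral do rewrite subrr normr0; rewrite Rintegral_cst// mul0r.
Qed.

Lemma algebra_compl p : A p -> A (fun x => 1 - p x).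
Proof.
move=> Ap; have := A_lin 1 (-1) (A_cst 1) Ap.
by under eq_fun do rewrite mulr1 mulN1r.
Qed.

Lemma approx01_compl f : approx01 f -> approx01 (fun x => 1 - f x).
Proof.
move=> [uf H]; split; first exact: unit_valued_compl.
move=> e e0; have [p [Ap up fp]] := H e e0.
exists (fun x => 1 - p x); split; [exact: algebra_compl|exact: unit_valued_compl|].
rewrite (_ : dist1 _ _ = dist1 f p)//; apply: eq_Rintegral => x _.
by rewrite (_ : (1 - f x) - (1 - p x) = - (f x - p x)) ?normrN//; ring.
Qed.

(** [f g - p q = (f - p) q + f (g - q)], where [q] and [f] are at most 1. *)
Lemma approx01_mul f g : approx01 f -> approx01 g -> approx01 (fun x => f x * g x).
Proof.
move=> [uf Hf] [ug Hg]; split; first exact: unit_valued_mul.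
move=> e e0; have [p [Ap up fp]] := Hf (e / 2) (divr_gt0 e0 (ltr0Sn R 1)).
have [q [Aq uq gq]] := Hg (e / 2) (divr_gt0 e0 (ltr0Sn R 1)).
exists (fun x => p x * q x); split; [exact: A_mul|exact: unit_valued_mul|].
apply: (@le_lt_trans _ _ (dist1 f p + dist1 g q)); last by lra.
apply: dist1_le => // [||x]; [exact: unit_valued_mul|exact: unit_valued_mul|].
have /andP[? ?] := uf.2 x; have /andP[? ?] := uq.2 x.
have -> : f x * g x - p x * q x = (f x - p x) * q x + f x * (g x - q x) by ring.
apply: (le_trans (ler_normD _ _)); rewrite !normrM (ger0_norm (_ : 0 <= f x))// (ger0_norm (_ : 0 <= q x))//.
by rewrite lerD// ?ler_piMr// ler_piMl.
Qed.

(** Dominated convergence with the constant 1, integrable as the measure is finite, makes some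
    [f_ N] close to [f] in [L^1]; then approximate [f_ N]. *)
Lemma approx01_lim (f_ : nat -> T -> R) f : (forall n, approx01 (f_ n)) ->
  measurable_fun setT f ->
  (forall x, f_ n x @[n --> \oo] --> f x) -> approx01 f.
Proof.
move=> H mf cf.
have uf : unit_valued f.
  split=> // x; have cvgx := cvgP _ (cf x); rewrite -(cvg_lim (@Rhausdorff R) (cf x)).
  apply/andP; split; [apply: limr_ge => //|apply: limr_le => //];
    by apply: nearW => n; have [[_ /(_ x) /andP[]]] := H n.
split=> // e e0.
have [_ + _] : [/\ mu.-integrable setT (EFin \o f),
    (\int[mu]_x `|(f_ n x)%:E - (f x)%:E|)%E @[n --> \oo] --> 0%E &
    (\int[mu]_x (f_ n x)%:E)%E @[n --> \oo] --> (\int[mu]_x (f x)%:E)%E].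
  apply: (@dominated_convergence _ _ _ mu setT measurableT
    (fun n x => (f_ n x)%:E) (EFin \o f) (cst 1%E)).
  - by move=> n; apply/measurable_EFinP; have [[]] := H n.
  - exact/measurable_EFinP.
  - by apply: aeW => x _; apply: cvg_EFin; [exact: nearW|exact: cf].
  - exact: finite_measure_integrable_cst.
  - apply: aeW => x n _; rewrite lee_fin; have [[_ /(_ x) /andP[? ?]] _] := H n.
    by rewrite ger0_norm.
have uD n : unit_valued (fun x => `|f_ n x - f x|).
  by apply: unit_valued_dist => //; have [] := H n.
have DE n : (\int[mu]_x `|(f_ n x)%:E - (f x)%:E| = (dist1 (f_ n) f)%:E)%E.
  rewrite /dist1 /Rintegral fineK//.
  exact: integrable_fin_num (unit_valued_integrable (uD n)).
under eq_fun do rewrite DE.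
move/fine_cvgP => [_] /cvgr_lt /(_ (e / 2)) /(_ (divr_gt0 e0 (ltr0Sn R 1)))[N _ hN].
have {hN}DN : dist1 (f_ N) f < e / 2 by have := hN N (leqnn N).
have [[uN HN]] := (H N, tt); have [p [Ap up fp]] := HN _ (divr_gt0 e0 (ltr0Sn R 1)).
exists p; split => //; apply: (@le_lt_trans _ _ (dist1 (f_ N) f + dist1 (f_ N) p)).
  apply: dist1_le => // x; rewrite (distrC (f_ N x)).
  by rewrite (le_trans _ (ler_normD _ _))// [X in _ <= `|X|](_ : _ = f x - p x)//; ring.
by lra.
Qed.

Lemma approx01_ae f g : approx01 f -> unit_valued g ->
  {ae mu, forall x, f x = g x} -> approx01 g.
Proof.
move=> [uf Hf] ug fg; split=> // e e0; have [p [Ap up fp]] := Hf e e0.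
exists p; split => //; move: fp; rewrite /dist1 /Rintegral.
rewrite (ae_eq_integral (EFin \o (fun x => `|g x - p x|)))//.
- apply/measurable_EFinP; exact: (unit_valued_dist uf up).1.
- apply/measurable_EFinP; exact: (unit_valued_dist ug up).1.
- by move: fg; apply: filterS => x fgx _; rewrite /= fgx.
Qed.

Definition approx_set E := measurable E /\ approx01 (\1_E).

Lemma unit_valued_indic E : measurable E -> unit_valued (\1_E).
Proof.
move=> mE; split; first exact: measurable_indic.
by move=> x; rewrite indicE; case: (_ \in _); rewrite lexx ler01.
Qed.

Lemma approx_setC E : approx_set E -> approx_set (~` E).
Proof.
move=> [mE aE]; split; first exact: measurableC.
rewrite (_ : \1_(~` E) = fun x => 1 - \1_E x); first exact: approx01_compl.
by apply/funext => x; rewrite !indicE in_setC; case: (_ \in _); rewrite ?subrr ?subr0.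
Qed.

Lemma approx01_cst (b : R) : 0 <= b <= 1 -> approx01 (fun=> b).
Proof. by move=> b01; apply: approx01_algebra. Qed.

Lemma approx_set0 : approx_set set0.
Proof. by split=> //; rewrite indic0; apply: approx01_cst; rewrite lexx ler01. Qed.

Lemma approx_setI E F : approx_set E -> approx_set F -> approx_set (E `&` F).
Proof.
move=> [mE aE] [mF aF]; split; first exact: measurableI.
by rewrite indicI; exact: approx01_mul.
Qed.

(** Intersections rather than unions, because the indicator is then the pointwise limit of finite
    products. *)
Lemma approx_set_bigcap (F : nat -> set T) : (forall n, approx_set (F n)) ->
  approx_set (\bigcap_n F n).
Proof.
move=> aF; have mI : measurable (\bigcap_n F n).
  by apply: bigcapT_measurable => n; have [] := aF n.
split=> //; pose f_ n x := \prod_(i < n) (\1_(F i) x : R).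
apply: (@approx01_lim f_); [|exact: measurable_indic|].
  elim=> [|n IH]; rewrite /f_.
    rewrite (_ : (fun x => _) = fun=> 1); first by apply: approx01_cst; rewrite lexx ler01.
    by apply/funext => x; rewrite big_ord0.
  rewrite (_ : (fun x => _) = (fun x => f_ n x * \1_(F n) x)).
    by apply: approx01_mul => //; have [] := aF n.
  by apply/funext => x; rewrite big_ord_recr.
move=> x; have [Fx|/existsNP[n Fx]] := pselect (forall n, F n x).
  rewrite indicE mem_set; last by move=> n _; exact: Fx.
  rewrite (_ : f_ ^~ x = fun=> 1); first exact: cvg_cst.
  by apply/funext => n; rewrite /f_ big1// => i _; rewrite indicE mem_set.
rewrite indicE memNset; last by move=> /(_ n I).
apply: cvg_near_cst; exists n.+1 => // m /= nm; rewrite /f_.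
by rewrite (bigD1 (Ordinal nm))//= indicE memNset// mul0r.
Qed.

Lemma approx_set_sigma : sigma_algebra setT approx_set.
Proof.
split; first exact: approx_set0.
  by move=> E aE; rewrite setTD; exact: approx_setC.
move=> F aF; rewrite -[\bigcup_ _ _]setCK setC_bigcup; apply: approx_setC.
by apply: approx_set_bigcap => n; exact: approx_setC.
Qed.

Lemma algebra_exp p n : A p -> A (fun x => p x ^+ n).
Proof.
move=> Ap; elim: n => [|n IH].
  by rewrite (_ : (fun x => _) = fun=> 1)//; apply/funext => x; rewrite expr0.
by rewrite (_ : (fun x => _) = fun x => p x * p x ^+ n);
  [exact: A_mul|apply/funext => x; rewrite exprS].
Qed.

(** For [0 < v <= 1] the functions [threshold_fun v (h x) n] are polynomials in [h], hence in the
    algebra; they have values in [[0, 1]] and converge to the indicator. *)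
Lemma approx_set_lt h (v : R) : A h -> (forall x, 0 <= h x <= 1) ->
  approx_set [set x | h x < v].
Proof.
move=> Ah h01; have mh := A_measurable Ah.
have mE : measurable [set x | h x < v].
  rewrite (_ : [set x | _] = setT `&` h @^-1` `]-oo, v[%classic).
    by apply: mh => //; exact: measurable_itv.
  by rewrite setTI; apply/seteqP; split => x; rewrite /= in_itv.
have [v0|v0] := leP v 0.
  rewrite (_ : [set x | _] = set0); first exact: approx_set0.
  apply/seteqP; split => x //=; have /andP[hx _] := h01 x.
  by rewrite ltNge (le_trans v0).
have [v1|v1] := leP v 1; last first.
  rewrite (_ : [set x | _] = ~` set0); first exact/approx_setC/approx_set0.
  rewrite setC0; apply/seteqP; split => x //= _; have /andP[_ hx] := h01 x.
  exact: le_lt_trans hx v1.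
split=> //; apply: (@approx01_lim (fun n x => threshold_fun v (h x) n)).
- move=> n; apply: approx01_algebra; last by move=> x; apply: threshold_fun01 => //; rewrite v0.
  apply: A_mul; first by apply/algebra_exp/algebra_compl/algebra_exp.
  apply/algebra_compl/algebra_exp/algebra_compl/algebra_exp.
  have := A_lin 1 (-1) Ah (A_cst v).
  by under eq_fun do rewrite mul1r mulN1r.
- exact: measurable_indic.
- move=> x; rewrite indicE; have -> : (x \in [set x | h x < v]) = (h x < v).
    by apply/idP/idP; rewrite inE.
  by apply: threshold_fun_cvg => //; rewrite v0.
Qed.

End algebra_density.

(** * From indicators to square-integrable functions *)

Section algebra_density_L2.
Import HBNNSimple.
Context d (T : measurableType d) (R : realType).
Variable mu : {finite_measure set T -> \bar R}.
Variable A : set (T -> R).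
Hypothesis A_measurable : forall p, A p -> measurable_fun setT p.
Hypothesis A_bounded : forall p, A p -> exists M : R, forall x, `|p x| <= M.
Hypothesis A_cst : forall c : R, A (fun=> c).
Hypothesis A_lin : forall (a b : R) p q, A p -> A q -> A (fun x => a * p x + b * q x).
Hypothesis A_sets : forall E, measurable E -> approx_set mu A E.
Implicit Types (u v p q : T -> R) (E : set T).

Definition dist2 u v : R := \int[mu]_x (u x - v x) ^+ 2.

Lemma algebra_Lfun p : A p -> p \in Lfun mu 2%:E.
Proof.
move=> Ap; have [M pM] := A_bounded Ap.
exact: Lfun2_bounded (A_measurable Ap) pM.
Qed.

Lemma sqr_dist_integrable u v : u \in Lfun mu 2%:E -> v \in Lfun mu 2%:E ->
  mu.-integrable setT (EFin \o (fun x => (u x - v x) ^+ 2)).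
Proof.
move=> u2 v2; have w2 := Lfun2_lincomb 1 (-1) u2 v2.
have := Lfun2M_integrable w2 w2; apply: eq_integrable => // x _ /=.
by rewrite mul1r mulN1r expr2.
Qed.

Lemma dist2_triangle u v w : u \in Lfun mu 2%:E -> v \in Lfun mu 2%:E ->
  w \in Lfun mu 2%:E -> dist2 u w <= 2 * dist2 u v + 2 * dist2 v w.
Proof.
move=> u2 v2 w2; have i1 := sqr_dist_integrable u2 v2; have i2 := sqr_dist_integrable v2 w2.
rewrite /dist2 -(Rintegral_lincomb 2 2 i1 i2); apply: le_Rintegral => //.
- exact: sqr_dist_integrable.
- exact: integrable_lincomb.
- move=> x _; have := sqr_ge0 ((u x - v x) - (v x - w x)).
  nra.
Qed.

Definition approx2 u := u \in Lfun mu 2%:E /\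
  forall e : R, 0 < e -> exists p, A p /\ dist2 u p < e.

Lemma approx2_closure u : u \in Lfun mu 2%:E ->
  (forall e : R, 0 < e -> exists v, approx2 v /\ dist2 u v < e) -> approx2 u.
Proof.
move=> u2 H; split=> // e e0; have e4 : 0 < e / 4 by lra.
have [v [[v2 Hv] uv]] := H _ e4; have [p [Ap vp]] := Hv _ e4.
exists p; split=> //; apply: le_lt_trans (dist2_triangle u2 v2 (algebra_Lfun Ap)) _.
by lra.
Qed.

Lemma approx2Z (a : R) u : approx2 u -> approx2 (fun x => a * u x).
Proof.
move=> [u2 Hu]; have au2 : (fun x => a * u x) \in Lfun mu 2%:E.
  by have := Lfun2_lincomb a 0 u2 u2; under eq_fun do rewrite mul0r addr0.
split=> // e e0; have a0 : 0 < a ^+ 2 + 1 by have := sqr_ge0 a; lra.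
have [p [Ap up]] := Hu _ (divr_gt0 e0 a0).
exists (fun x => a * p x); split.
  by have := A_lin a 0 Ap Ap; under eq_fun do rewrite mul0r addr0.
have -> : dist2 (fun x => a * u x) (fun x => a * p x) = a ^+ 2 * dist2 u p.
  rewrite /dist2 -RintegralZl//; last exact: sqr_dist_integrable u2 (algebra_Lfun Ap).
  by apply: eq_Rintegral => x _; ring.
have d0 : 0 <= dist2 u p by apply: Rintegral_ge0 => x _; exact: sqr_ge0.
rewrite ltr_pdivlMr// mulrDr mulr1 in up.
by have := sqr_ge0 a; lra.
Qed.

Lemma approx2D u v : approx2 u -> approx2 v -> approx2 (fun x => u x + v x).
Proof.
move=> [u2 Hu] [v2 Hv]; have uv2 : (fun x => u x + v x) \in Lfun mu 2%:E.
  by have := Lfun2_lincomb 1 1 u2 v2; under eq_fun do rewrite !mul1r.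
split=> // e e0; have e4 : 0 < e / 4 by lra.
have [p [Ap up]] := Hu _ e4; have [q [Aq vq]] := Hv _ e4.
have Apq : A (fun x => p x + q x).
  by have := A_lin 1 1 Ap Aq; under eq_fun do rewrite !mul1r.
exists (fun x => p x + q x); split => //.
have i1 := sqr_dist_integrable u2 (algebra_Lfun Ap); have i2 := sqr_dist_integrable v2 (algebra_Lfun Aq).
apply: (@le_lt_trans _ _ (2 * dist2 u p + 2 * dist2 v q)); last by lra.
rewrite /dist2 -(Rintegral_lincomb 2 2 i1 i2); apply: le_Rintegral => //.
- exact: sqr_dist_integrable uv2 (algebra_Lfun Apq).
- exact: integrable_lincomb.
- move=> x _; have := sqr_ge0 ((u x - p x) - (v x - q x)).
  nra.
Qed.

(** The difference of two functions with values in [[0, 1]] has modulus at most 1, so its square is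
    at most its modulus and the [L^1] approximant serves in [L^2]. *)
Lemma approx2_indic E : measurable E -> approx2 (\1_E).
Proof.
move=> mE; have [_ [uE H]] := A_sets mE.
have E2 : (\1_E : T -> R) \in Lfun mu 2%:E.
  apply: (@Lfun2_bounded _ _ _ _ _ 1); first exact: uE.1.
  by move=> x; have /andP[? ?] := uE.2 x; rewrite ger0_norm.
split=> // e e0; have [p [Ap up Ep]] := H e e0.
exists p; split=> //; apply: le_lt_trans Ep; apply: le_Rintegral => //.
- exact: sqr_dist_integrable E2 (algebra_Lfun Ap).
- exact: unit_valued_integrable (unit_valued_dist uE up).
- move=> x _; have /andP[? ?] := (unit_valued_dist uE up).2 x.
  by rewrite -real_normK ?num_real// expr2 ler_piMr.
Qed.

Lemma approx2_0 : approx2 (fun=> 0).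
Proof. by have := approx2_indic measurable0; rewrite indic0. Qed.

Lemma approx2_sum (I : Type) (s : seq I) (F : I -> T -> R) :
  (forall i, approx2 (F i)) -> approx2 (fun x => \sum_(i <- s) F i x).
Proof.
move=> HF; elim: s => [|i s IH].
  by under eq_fun do rewrite big_nil; exact: approx2_0.
by under eq_fun do rewrite big_cons; exact: approx2D.
Qed.

Lemma approx2_nnsfun (f : {nnsfun T >-> R}) : approx2 f.
Proof.
rewrite (_ : (f : T -> R) = fun x =>
    \sum_(y <- finmap.enum_fset (fset_set (range f))) (y * \1_(f @^-1` [set y]) x)); last first.
  by apply/funext => x; rewrite [LHS]fimfunE fsbig_finite.
by apply: approx2_sum => y; apply: approx2Z; apply: approx2_indic.
Qed.

(** Simple functions increase to [u], and the squared differences are dominated by [u^2]. *)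
Lemma approx2_nonneg u : u \in Lfun mu 2%:E -> (forall x, 0 <= u x) -> approx2 u.
Proof.
move=> u2 u0; have mu_ := Lfun_measurable u2.
have mEu : measurable_fun setT (EFin \o u) by exact/measurable_EFinP.
pose g := nnsfun_approx measurableT mEu.
have gcvg x : (g n x : R) @[n --> \oo] --> u x.
  have uE0 y : setT y -> (0 <= (EFin \o u) y)%E by move=> _; rewrite /= lee_fin.
  by have /fine_cvgP[_] := cvg_nnsfun_approx measurableT mEu uE0 (I : setT x).
have gu n x : g n x <= u x.
  rewrite -(cvg_lim (@Rhausdorff R) (gcvg x)); apply: nondecreasing_cvgn_le.
    by move=> i k ik; have /lefP := nd_nnsfun_approx measurableT mEu ik; exact.
  exact: cvgP (gcvg x).
have g0 n x : 0 <= g n x by [].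
have g2 n : (g n : T -> R) \in Lfun mu 2%:E by have [] := approx2_nnsfun (g n).
apply: approx2_closure => // e e0.
have i2 := Lfun2M_integrable u2 u2.
have [_ _] : [/\ mu.-integrable setT (fun=> 0%E),
    (\int[mu]_x `|((u x - g n x) ^+ 2)%:E - 0|)%E @[n --> \oo] --> 0%E &
    (\int[mu]_x ((u x - g n x) ^+ 2)%:E)%E @[n --> \oo] --> (\int[mu]_x 0)%E].
  apply: (@dominated_convergence _ _ _ mu setT measurableT
    (fun n x => ((u x - g n x) ^+ 2)%:E) (fun=> 0%E) (fun x => (u x * u x)%:E)).
  - move=> n; apply/measurable_EFinP; apply: measurable_funX.
    by apply: measurable_funB => //; exact: Lfun_measurable (g2 n).
  - exact: measurable_cst.
  - apply: aeW => x _; apply: cvg_EFin; first exact: nearW.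
    have h : u x - g n x @[n --> \oo] --> (u x - u x : R).
      by apply: cvgB; [exact: cvg_cst|exact: gcvg].
    by rewrite subrr in h; have := cvgM h h; rewrite mulr0; exact.
  - exact: i2.
  - apply: aeW => x n _; rewrite lee_fin ger0_norm ?sqr_ge0//.
    by have := gu n x; have := g0 n x; nra.
rewrite integral0 => /fine_cvgP[_] /cvgr_lt /(_ e) /(_ e0)[N _ hN].
by exists (g N); split; [exact: approx2_nnsfun|exact: (hN N (leqnn N))].
Qed.

Lemma Lfun2_abs u : u \in Lfun mu 2%:E -> (fun x => `|u x|) \in Lfun mu 2%:E.
Proof.
rewrite !inE/= => /andP[mu_ fu]; apply/andP; split.
  by rewrite inE; apply: measurableT_comp => //; rewrite inE in mu_.
move: fu; rewrite !inE /finite_norm /=.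
rewrite (_ : EFin \o (fun x => `|u x|) = (abse \o (EFin \o u))%E).
  by rewrite Lnorm_abse.
by apply/funext => x.
Qed.

Lemma algebra_density_L2 u : u \in Lfun mu 2%:E -> approx2 u.
Proof.
move=> u2; have a2 := Lfun2_abs u2.
have h1 : approx2 (fun x => 2^-1 * `|u x| + 2^-1 * u x).
  apply: approx2_nonneg => [|x]; first exact: Lfun2_lincomb.
  by have := ler_norm (- u x); rewrite normrN; lra.
have h2 : approx2 (fun x => 2^-1 * `|u x| + (- 2^-1) * u x).
  apply: approx2_nonneg => [|x]; first exact: Lfun2_lincomb.
  by have := ler_norm (u x); lra.
have := approx2D h1 (approx2Z (-1) h2).
by rewrite (_ : (fun x => _) = u)//; apply/funext => x; field.
Qed.

End algebra_density_L2.

(** * The order on the circle in terms of sine and cosine *)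

Section circle_order.
Context (R : realType).
Implicit Types (t a : R).

Lemma cos_reflect t : cos (2 * pi - t) = cos t.
Proof. by rewrite addrC mulr_natl cosD2pi cosN. Qed.

Lemma sin_lt0_lower t : pi < t < 2 * pi -> sin t < 0.
Proof.
move=> /andP[t1 t2]; rewrite -(subrK pi t) sinDpi oppr_lt0 sin_gt0_pi//.
by apply/andP; split; lra.
Qed.

(** For [a] in the upper half, [t <= a] means that [t] is in the upper half too, where sine is
    nonnegative and cosine decreases. *)
Lemma ltr_upper t a : 0 < t < 2 * pi -> 0 <= a <= pi ->
  (a < t) = ~~ ((0 <= sin t) && (cos a <= cos t)).
Proof.
move=> /andP[t0 t2] /andP[a0 api]; have [tpi|tpi] := leP t pi; last first.
  by rewrite leNgt sin_lt0_lower ?tpi//= (le_lt_trans api).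
have s0 : 0 <= sin t by apply: sin_ge0_pi; rewrite (ltW t0).
by rewrite s0 /= -ltNge ltr_cos// in_itv/= ?(ltW t0) ?a0.
Qed.

(** The reflection [2 pi - t] carries the lower half to the upper one and preserves cosine, so
    cosine increases on the lower half. *)
Lemma ltr_lower t a : 0 < t < 2 * pi -> pi < a < 2 * pi ->
  (a < t) = (sin t < 0) && (cos a < cos t).
Proof.
move=> /andP[t0 t2] /andP[a1 a2]; have [tpi|tpi] := leP t pi.
  rewrite ltNge (le_trans tpi (ltW a1))/= ltNge sin_ge0_pi//.
  by rewrite (ltW t0).
rewrite sin_lt0_lower ?tpi//= -(cos_reflect a) -(cos_reflect t).
rewrite ltr_cos ?in_itv/=; first by rewrite ltrD2l ltrN2.
  by apply/andP; split; lra.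
by apply/andP; split; lra.
Qed.

End circle_order.

(** * Trigonometric polynomials generate the measurable sets *)

Section trigonometric_polynomials.
Local Open Scope complex_scope.
Context (R : realType) (d : nat).
Notation point := (d.-tuple (measurableTypeR R)).
Notation mu := (@torus_measure R d).
Implicit Types (p q : point -> R[i]) (k l : 'I_d -> int).

Inductive trig_poly : (point -> R[i]) -> Prop :=
| trig_exp k : trig_poly (fun x => expi (phase k x))
| trig_lin (a b : R[i]) p q : trig_poly p -> trig_poly q ->
    trig_poly (fun x => a * p x + b * q x).

Lemma expiD (s t : R) : expi (s + t) = expi s * expi t.
Proof.
by rewrite /expi cosD sinD; apply/eqP; rewrite eq_complex /=; apply/andP; split; apply/eqP; ring.
Qed.

Lemma phaseD k l (x : point) : phase (fun j => k j + l j) x = phase k x + phase l x.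
Proof.
by rewrite /phase -big_split; apply: eq_bigr => j _; rewrite intrD mulrDl.
Qed.

Lemma trig_mul p q : trig_poly p -> trig_poly q -> trig_poly (fun x => p x * q x).
Proof.
move=> tp; elim: tp q => [k|a b p1 p2 _ IH1 _ IH2] q tq.
  elim: tq => [l|a b q1 q2 _ IH1 _ IH2].
    rewrite (_ : (fun x => _) = fun x => expi (phase (fun j => k j + l j) x)).
      exact: trig_exp.
    by apply/funext => x; rewrite phaseD expiD.
  rewrite (_ : (fun x => _) = fun x => a * (expi (phase k x) * q1 x) + b * (expi (phase k x) * q2 x)).
    exact: trig_lin.
  by apply/funext => x; ring.
rewrite (_ : (fun x => _) = fun x => a * (p1 x * q x) + b * (p2 x * q x)).
  by apply: trig_lin; [exact: IH1|exact: IH2].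
by apply/funext => x; ring.
Qed.

Lemma trig_cst (c : R[i]) : trig_poly (fun=> c).
Proof.
rewrite (_ : (fun=> c) = fun x => c * expi (phase (fun=> 0) x) + 0 * expi (phase (fun=> 0) x)).
  by apply: trig_lin; exact: trig_exp.
apply/funext => x; rewrite mul0r addr0 (_ : phase _ x = 0).
  by rewrite /expi cos0 sin0; exact: (esym (mulr1 _)).
by rewrite /phase big1// => j _; rewrite mul0r.
Qed.

Lemma trig_ReIm p : trig_poly p ->
  (measurable_fun setT (fun x => complex.Re (p x)) /\
   measurable_fun setT (fun x => complex.Im (p x))) /\
  exists M : R, forall x, `|complex.Re (p x)| <= M /\ `|complex.Im (p x)| <= M.
Proof.
elim=> [k|[a1 a2] [b1 b2] p1 p2 _ [[mr1 mi1] [M1 h1]] _ [[mr2 mi2] [M2 h2]]].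
  split; first by split; [exact: measurable_cos_phase|exact: measurable_sin_phase].
  by exists 1 => x; split; [exact: cos_max|exact: sin_max].
have Mreal u v w z (f g h j : point -> R) : measurable_fun setT f -> measurable_fun setT g ->
    measurable_fun setT h -> measurable_fun setT j ->
    measurable_fun setT (fun x => (u * f x + v * g x) + (w * h x + z * j x)).
  by move=> *; apply: measurable_funD; apply: measurable_funD; apply: measurable_funM.
have ReE x : complex.Re ((a1 +i* a2) * p1 x + (b1 +i* b2) * p2 x) =
    (a1 * complex.Re (p1 x) + (- a2) * complex.Im (p1 x)) +
    (b1 * complex.Re (p2 x) + (- b2) * complex.Im (p2 x)).
  by case: (p1 x) (p2 x) => [? ?] [? ?] /=; ring.
have ImE x : complex.Im ((a1 +i* a2) * p1 x + (b1 +i* b2) * p2 x) =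
    (a1 * complex.Im (p1 x) + a2 * complex.Re (p1 x)) +
    (b1 * complex.Im (p2 x) + b2 * complex.Re (p2 x)).
  by case: (p1 x) (p2 x) => [? ?] [? ?] /=; ring.
split.
  by split; [under eq_fun do rewrite ReE|under eq_fun do rewrite ImE]; exact: Mreal.
exists ((`|a1| + `|a2|) * M1 + (`|b1| + `|b2|) * M2) => x; rewrite ReE ImE.
have [r1 i1] := h1 x; have [r2 i2] := h2 x.
have B (M u v m n : R) : `|m| <= M -> `|n| <= M -> `|u * m + v * n| <= (`|u| + `|v|) * M.
  by move=> hm hn; rewrite (le_trans (ler_normD _ _))// !normrM mulrDl lerD// ler_wpM2l.
split; apply: (le_trans (ler_normD _ _)); apply: lerD.
- by have := B _ a1 (- a2) _ _ r1 i1; rewrite normrN.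
- by have := B _ b1 (- b2) _ _ r2 i2; rewrite normrN.
- exact: B.
- exact: B.
Qed.

Definition real_trig : set (point -> R) := [set p : point -> R | trig_poly (fun x => (p x)%:C)].

Lemma real_trig_measurable (p : point -> R) : real_trig p -> measurable_fun setT p.
Proof. by move=> /trig_ReIm[[]]. Qed.

Lemma real_trig_bounded (p : point -> R) : real_trig p -> exists M : R, forall x, `|p x| <= M.
Proof. by move=> /trig_ReIm[_ [M H]]; exists M => x; have [] := H x. Qed.

Lemma real_trig_cst (c : R) : real_trig (fun=> c).
Proof. exact: trig_cst. Qed.

Lemma real_trig_lin (a b : R) (p q : point -> R) : real_trig p -> real_trig q ->
  real_trig (fun x => a * p x + b * q x).
Proof.
move=> tp tq; have := trig_lin a%:C b%:C tp tq.
by rewrite /real_trig /=; congr trig_poly; apply/funext => x; rewrite rmorphD !rmorphM.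
Qed.

Lemma real_trig_mul (p q : point -> R) : real_trig p -> real_trig q -> real_trig (fun x => p x * q x).
Proof.
move=> tp tq; have := trig_mul tp tq.
by rewrite /real_trig /=; congr trig_poly; apply/funext => x; rewrite rmorphM.
Qed.

Definition unit_freq (j : 'I_d) (a : int) : 'I_d -> int := fun i => if i == j then a else 0.

Lemma phase_unit_freq j a (x : point) : phase (unit_freq j a) x = a%:~R * (tnth x j : R).
Proof.
rewrite /phase (bigD1 j)//= /unit_freq eqxx big1 ?addr0// => i ij.
by rewrite (negbTE ij) mul0r.
Qed.

Lemma real_trig_cos j : real_trig (fun x => cos (tnth x j : R)).
Proof.
have := trig_lin (2^-1)%:C (2^-1)%:C (trig_exp (unit_freq j 1)) (trig_exp (unit_freq j (-1))).
rewrite /real_trig /=; congr trig_poly; apply/funext => x.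
rewrite !phase_unit_freq mul1r mulN1r /expi cosN sinN.
by apply/eqP; rewrite eq_complex /=; apply/andP; split; apply/eqP; field.
Qed.

Lemma real_trig_sin j : real_trig (fun x => sin (tnth x j : R)).
Proof.
have := trig_lin (0 -i* (2^-1)) (0 +i* (2^-1)) (trig_exp (unit_freq j 1)) (trig_exp (unit_freq j (-1))).
rewrite /real_trig /=; congr trig_poly; apply/funext => x.
rewrite !phase_unit_freq mul1r mulN1r /expi cosN sinN.
by apply/eqP; rewrite eq_complex /=; apply/andP; split; apply/eqP; field.
Qed.

Let approx := approx_set mu real_trig.

Lemma approx_lt h (v : R) : real_trig h -> (forall x, `|h x| <= 1) ->
  approx [set x | h x < v].
Proof.
(* An affine change takes [[-1, 1]] to the interval [[0, 1]] required by [approx_set_lt], and the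
   level [v] to [(v + 1) / 2]. *)
move=> th h1; rewrite (_ : [set x | _] = [set x | 2^-1 * h x + 2^-1 * 1 < (v + 1) / 2]).
  apply: (approx_set_lt mu real_trig_measurable real_trig_cst real_trig_lin real_trig_mul).
    exact: real_trig_lin th (real_trig_cst 1).
  by move=> x; have := h1 x; rewrite ler_norml; lra.
by apply/seteqP; split => x /=; lra.
Qed.

Let appC := approx_setC real_trig_cst real_trig_lin (mu := mu).
Let appI := approx_setI real_trig_mul (mu := mu).

(** It suffices to find an approximable set that agrees with the half-space where the coordinate
    lies strictly between [0] and [2 pi], by [torus_interior]. It is built from sublevel sets of
    sine and cosine, according to whether [a] lies in the upper or the lower half. *)
Lemma approx_coord_ray j (a : R) : approx ((fun x : point => tnth x j : R) @^-1` `]a, +oo[).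
Proof.
have mE : measurable ((fun x : point => tnth x j : R) @^-1` `]a, +oo[).
  rewrite -[X in measurable X]setTI; apply: measurable_coord => //; exact: measurable_itv.
suff [F [aF FE]] : exists F, approx F /\
    forall x : point, 0 < (tnth x j : R) < 2 * pi -> (F x <-> a < (tnth x j : R)).
  split=> //; have aFae : {ae mu, forall x, \1_F x = \1_((fun x : point => tnth x j : R) @^-1` `]a, +oo[) x :> R}.
    have := torus_interior R d; apply: (@filterS _ _ (ae_filter_ringOfSetsType mu)) => x /(_ j) hx.
    rewrite !indicE; congr (_%:R); congr nat_of_bool.
    by apply/idP/idP; rewrite !inE /= in_itv/= andbT => /(FE x hx).
  by apply: approx01_ae aF.2 _ aFae; exact: unit_valued_indic.
have tc := real_trig_cos j; have ts := real_trig_sin j.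
have [a0|a0] := ltP a 0.
  exists setT; split; first by rewrite -setC0; apply: appC; exact: (approx_set0 mu real_trig_measurable real_trig_cst).
  by move=> x /andP[x0 _]; split => // _; exact: lt_trans x0.
have [a2|a2] := leP (2 * pi) a.
  exists set0; split; first exact: (approx_set0 mu real_trig_measurable real_trig_cst).
  by move=> x /andP[_ x2]; split => // ax; have := lt_trans ax x2; rewrite ltNge a2.
have [api|api] := leP a pi.
  exists (~` (~` [set x | sin (tnth x j : R) < 0] `&` ~` [set x | cos (tnth x j : R) < cos a])).
  split.
    apply: appC; apply: appI; apply: appC; apply: approx_lt => // x; [exact: sin_max|exact: cos_max].
  move=> x hx; rewrite (ltr_upper hx) ?a0//= !leNgt negb_and !negbK; split.
    by move/not_andP => [/contrapT ->|/contrapT ->//]; rewrite ?orbT.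
  by move=> /orP[h1|h2] [h3 h4]; [exact: h3|exact: h4].
(* Only strict sublevel sets are at hand, so [cos a < cos t] is written with minus signs. *)
exists ([set x | sin (tnth x j : R) < 0] `&` [set x | - cos (tnth x j : R) < - cos a]).
split.
  apply: appI; apply: approx_lt => //.
  - by move=> x; exact: sin_max.
  - have := real_trig_lin (-1) 0 tc tc.
    by under eq_fun do rewrite mulN1r mul0r addr0.
  - by move=> x; rewrite normrN; exact: cos_max.
move=> x hx; rewrite (ltr_lower hx) ?api//= ltrN2; split; first by move=> [-> ->].
by move=> /andP[].
Qed.

Lemma approx_coord j (B : set (measurableTypeR R)) : measurable B ->
  approx ((fun x : point => tnth x j) @^-1` B).
Proof.
have sa := approx_set_sigma mu real_trig_measurable real_trig_cst real_trig_lin real_trig_mul.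
have [s0 sC sU] := sa.
pose P (B : set R) := approx ((fun x : point => tnth x j : R) @^-1` B).
suff sub : (ocitv (R := R)).-sigma.-measurable `<=` P by exact: sub.
rewrite RGenOInfty.measurableE; apply: smallest_sub => [|_ [a ->]]; last exact: approx_coord_ray.
split => [|E aE|F aF]; rewrite /P.
- by rewrite preimage_set0.
- by rewrite setTD preimage_setC -setTD; exact: sC.
- by rewrite preimage_bigcup; exact: sU.
Qed.

Lemma approx_measurable (E : set point) : measurable E -> approx E.
Proof.
apply: smallest_sub.
  exact: (approx_set_sigma mu real_trig_measurable real_trig_cst real_trig_lin real_trig_mul).
move=> E'; rewrite -bigcup_seq => -[j _ [B mB <-]].
by rewrite setTI; exact: approx_coord.
Qed.

End trigonometric_polynomials.

(** * Parseval and conclusion *)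

Section torus_parseval.
Local Open Scope complex_scope.
Context (R : realType) (d : nat).
Notation point := (d.-tuple (measurableTypeR R)).
Notation mu := (@torus_measure R d).
Implicit Types (f g : L2T R d) (k : 'I_d -> int).

Lemma trig_poly_span (p : point -> R[i]) : trig_poly p ->
  exists2 g : L2T R d, in_span (@fourier_coef R d) (@fourier_basis R d) g &
    {ae mu, forall x, L2_to_fun g x = p x}.
Proof.
have lin := @fourier_coef_linear R d; have ort := @fourier_coef_basis R d.
elim=> [k|a b p1 p2 _ [g1 s1 e1] _ [g2 s2 e2]].
  have K0 : fourier_scale R d != 0 by rewrite gt_eqF// powR_gt0// pi2_gt0.
  exists (((fourier_scale R d)^-1)%:C *: fourier_basis R k); first exact: in_span_basis.
  (* Scaling is read off from a combination with the zero class, whose chosen representative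
     vanishes almost everywhere by [z0]. *)
  have := L2_to_fun_lin ((fourier_scale R d)^-1)%:C (fourier_basis R k) 0.
  rewrite addr0; have z0 := L2_to_fun_lin (-1) (fourier_basis R k) (fourier_basis R k).
  rewrite scaleN1r addNr in z0.
  move: z0 (fourier_basisE R k); apply: filterS3 => x -> -> ->.
  rewrite mulN1r addNr addr0 /expi; apply/eqP; rewrite eq_complex /=.
  by apply/andP; split; apply/eqP; field.
exists (a *: g1 + b *: g2); first exact: in_span_lin.
have z0 := L2_to_fun_lin (-1) g2 g2; rewrite scaleN1r addNr in z0.
have H1 := L2_to_fun_lin a g1 (b *: g2); have H2 := L2_to_fun_lin b g2 0.
rewrite addr0 in H2.
have H12 : {ae mu, forall x, L2_to_fun (a *: g1 + b *: g2) x =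
    a * L2_to_fun g1 x + b * L2_to_fun g2 x}.
  by move: z0 H1 H2; apply: filterS3 => x h0 -> ->; rewrite h0 mulN1r addNr addr0.
by move: e1 e2 H12; apply: filterS3 => x -> -> ->.
Qed.

(** The real and imaginary parts are approximated separately by real trigonometric polynomials [p]
    and [q]; then [p + i q] is in the complex span. *)
Lemma trig_dense f (e : R) : 0 < e ->
  exists2 g, in_span (@fourier_coef R d) (@fourier_basis R d) g & L2norm (f - g) ^+ 2 < e.
Proof.
move=> e0; have [u [v [u2 v2 fuv]]] := L2_ReIm f.
have dens (w : point -> R) (w2 : w \in Lfun mu 2%:E) :=
  algebra_density_L2 (@real_trig_measurable R d) (@real_trig_bounded R d)
    (@real_trig_lin R d) (@approx_measurable R d) w2.
have e2 : 0 < e / 2 by lra.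
have [p [tp up]] := (dens u u2).2 _ e2; have [q [tq vq]] := (dens v v2).2 _ e2.
have p2 := algebra_Lfun mu (@real_trig_measurable R d) (@real_trig_bounded R d) tp.
have q2 := algebra_Lfun mu (@real_trig_measurable R d) (@real_trig_bounded R d) tq.
have [g gs gE] := trig_poly_span (trig_lin 1 'i tp tq).
exists g => //.
have e' : {ae mu, forall x, L2_to_fun (f - g) x = (1 * u x + (-1) * p x) +i* (1 * v x + (-1) * q x)}.
  have := L2_to_fun_lin (-1) g f; rewrite scaleN1r addrC.
  move: fuv gE; apply: filterS3 => x -> -> ->.
  by apply/eqP; rewrite eq_complex /=; apply/andP; split; apply/eqP; ring.
rewrite (L2norm_sqr (Lfun2_lincomb 1 (-1) u2 p2) (Lfun2_lincomb 1 (-1) v2 q2) e').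
have := Rintegral_lincomb 1 1 (sqr_dist_integrable u2 p2) (sqr_dist_integrable v2 q2).
rewrite !mul1r => h; apply: (@le_lt_trans _ _ (dist2 mu u p + dist2 mu v q)); last by lra.
rewrite /dist2 -h le_eqVlt; apply/orP; left; apply/eqP.
by apply: eq_Rintegral => x _; rewrite !mul1r !mulN1r.
Qed.

Definition torus_weight k : R := \prod_(j < d) (1 + `|(k j)%:~R| ^+ 2).

Lemma torus_weight_ge1 k : 1 <= torus_weight k.
Proof.
rewrite /torus_weight; elim/big_rec: _ => // j x _ x1.
by rewrite -[leLHS]mulr1 ler_pM// lerDl sqr_ge0.
Qed.

Lemma torus_weightE k : torus_weight k = weight k ^+ 2.
Proof.
rewrite /torus_weight /weight -prodrXl; apply: eq_bigr => j _.
rewrite sqr_sqrtr; last by rewrite addr_ge0 ?sqr_ge0.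
by rewrite natr_absz intr_norm.
Qed.

Lemma HmixE s : Hmix d s = wspace (@fourier_coef R d) torus_weight s.
Proof.
have E : Hmix_norm2 s = wnorm2 (@fourier_coef R d) torus_weight s.
  apply/funext => f; apply: eq_esum => k _; congr ((_ * _)%:E).
  rewrite /torus_weight; elim: (index_enum _) => [|j r IH]; first by rewrite !big_nil powR1.
  rewrite !big_cons powRM ?IH ?addr_ge0 ?sqr_ge0//.
  by apply: prodr_ge0 => i _; rewrite addr_ge0 ?sqr_ge0.
by rewrite /Hmix /wspace E.
Qed.

(** Parseval makes carriers and norms coincide, so the embedding into [L_2] is the case [s1 = 0] of
    the general one. *)
Lemma L2_spaceE : L2_space R d = Hmix d 0.
Proof.
rewrite HmixE; have P := parseval torus_weight (@fourier_coef_linear R d) (@fourier_coef_basis R d)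
  (fun f => sqr_ge0 (L2norm f)) (@L2norm_sqr_sub R d) trig_dense.
rewrite /wspace /L2_space; congr NormedSubspace.
  by apply/seteqP; split => f //= _; rewrite P ltry.
by apply/funext => f; rewrite P /= sqrtr_sqr ger0_norm// sqrtr_ge0.
Qed.

Lemma fine_le_EFin (x : \bar R) (b : R) : 0 <= b -> (x <= b%:E)%E -> fine x <= b.
Proof. by case: x. Qed.

Lemma powR_weight k (t : R) : torus_weight k `^ t = (weight k `^ t) ^+ 2.
Proof. by rewrite torus_weightE expr2 powRM ?(le_trans ler01 (weight_ge1 k))// expr2. Qed.

Lemma torus_weight_gt0 k : 0 < torus_weight k.
Proof. exact: lt_le_trans (torus_weight_ge1 k). Qed.

Lemma approximation_number_le (s0 s1 r : R) n : s1 < s0 -> (0 < n)%N -> 0 < r ->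
  lattice_count d r < n%:R ->
  approximation_number (Hmix d s0) (Hmix d s1) n idfun <= r `^ (- (s0 - s1)).
Proof.
move=> s10 n0 r0 rn; rewrite !HmixE; apply: fine_le_EFin; first exact: powR_ge0.
have d0 : 0 <= s0 - s1 by lra.
apply: (approximation_upper (@fourier_coef_linear R d) (@fourier_coef_basis R d)
  torus_weight_ge1 (lattice_points_uniq d r)); rewrite ?powR_ge0 ?(ltW s10)//.
  by rewrite -(ltr_nat R) size_lattice_points.
move=> k; rewrite mem_lattice_points -ltNge => rk.
(* After division by the power with exponent [s1], the claim is that the square of
   [(weight k / r)^(s0 - s1)] is at least 1. *)
have -> : s0 = (s0 - s1) + s1 by ring.
rewrite powRD; last by rewrite (gt_eqF (torus_weight_gt0 k)) implybT.
rewrite addrK mulrA ler_peMl ?powR_ge0// powR_weight -exprMn exprn_ege1//.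
rewrite powRN ler_pdivlMl ?powR_gt0// mulr1.
by rewrite ge0_ler_powR ?nnegrE ?(ltW r0) ?(ltW rk)// ltW// (lt_trans r0).
Qed.

Lemma approximation_number_ge (s0 s1 r : R) n : s1 < s0 -> (0 < n)%N -> 0 < r ->
  n%:R <= lattice_count d r ->
  r `^ (- (s0 - s1)) <= approximation_number (Hmix d s0) (Hmix d s1) n idfun.
Proof.
move=> s10 n0 r0 rn; rewrite !HmixE.
have d0 : 0 <= s0 - s1 by lra.
have lo : ((r `^ (- (s0 - s1)))%:E <=
    approximation_ereal (@fourier_coef R d) torus_weight s0 s1 n)%E.
  apply: (approximation_lower (@fourier_coef_linear R d) (@fourier_coef_basis R d)
    torus_weight_ge1 (lattice_points_uniq d r)); rewrite ?powR_ge0//.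
    by rewrite -(ler_nat R) size_lattice_points.
  move=> k; rewrite mem_lattice_points => rk.
  have -> : s0 = (s0 - s1) + s1 by ring.
  rewrite powRD; last by rewrite (gt_eqF (torus_weight_gt0 k)) implybT.
  rewrite addrK mulrA ler_piMl ?powR_ge0// powR_weight -exprMn exprn_ile1//.
    by rewrite mulr_ge0 ?powR_ge0.
  rewrite powRN ler_pdivrMl ?powR_gt0// mulr1.
  by rewrite ge0_ler_powR ?nnegrE ?(ltW r0) ?(le_trans ler01 (weight_ge1 k)).
(* The truncation to the empty sequence is the zero operator, of rank less than [n] as [n > 0]. Its
   error is at most 1, which excludes the value [+oo] that [fine] would send to 0. *)
have up : (approximation_ereal (@fourier_coef R d) torus_weight s0 s1 n <= 1%:E)%E.
  apply: (@approximation_upper _ _ _ _ (@fourier_basis R d) _ (@fourier_coef_linear R d) (@fourier_coef_basis R d)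
    torus_weight_ge1 s0 s1 1 [::] n) => //; first exact: ltW.
  by move=> k _; rewrite expr1n mul1r ler_powR ?torus_weight_ge1// ltW.
move: lo up; rewrite /approximation_number -/(approximation_ereal _ _ _ _ _).
by case: (approximation_ereal _ _ _ _ _) => [x||]; rewrite ?lee_fin.
Qed.

End torus_parseval.

Theorem corollary4p14 (R : realType) (d : nat) (d_gt0 : (0 < d)%N) :
  (forall s : R, 0 < s ->
     n%:R `^ s * approximation_number (Hmix d s) (L2_space R d) n idfun
       / ln n%:R `^ ((d%:R - 1) * s)
     @[n --> \oo] --> (2 ^+ d / (d.-1)`!%:R) `^ s)
  /\
  (forall s0 s1 : R, s1 < s0 -> 0 <= s1 ->
     n%:R `^ (s0 - s1) * approximation_number (Hmix d s0) (Hmix d s1) n idfun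
       / ln n%:R `^ ((d%:R - 1) * (s0 - s1))
     @[n --> \oo] --> (2 ^+ d / (d.-1)`!%:R) `^ (s0 - s1)).
Proof.
suff main (s0 s1 : R) : s1 < s0 ->
    n%:R `^ (s0 - s1) * approximation_number (Hmix d s0) (Hmix d s1) n idfun
       / ln n%:R `^ ((d%:R - 1) * (s0 - s1))
     @[n --> \oo] --> (2 ^+ d / (d.-1)`!%:R) `^ (s0 - s1).
  split=> [s s_gt0|s0 s1 s10 _]; last exact: main.
  by have := main s 0 s_gt0; rewrite subr0 L2_spaceE.
move=> s10; have s_gt0 : 0 < s0 - s1 by rewrite subr_gt0.
(* The asymptotics are stated in dimension [d + 1] with logarithmic exponent [d], so the dimension
   is rewritten as a successor. *)
rewrite -[in d%:R](prednK d_gt0) -natr1 addrK -[in 2 ^+ d](prednK d_gt0).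
apply: cvg_approximation_scale => // n r n0 r0; rewrite (prednK d_gt0).
- exact: approximation_number_ge.
- exact: approximation_number_le.
Qed.
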